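(* Let $A=\varinjlim(A_i,\varphi_i)$ be the inductive limit of a sequence of $C^*$-algebras $A_i=\bigoplus_{t=1}^{k_i}M_{n_{it}}(B_{it})$ $(i=1,2,\dots)$, where the $B_{it}$ are $C^*$-algebras and $\varphi_i\colon A_i\to A_{i+1}$ are $*$-homomorphisms. For each $i,t$ let $S_{it}$ be a set of self-adjoint elements of $B_{it}$ that spans $B_{it}$ as a vector space, and put $S_i=\bigcup_{t=1}^{k_i}S_{it}$. Then the following are equivalent: (i) $A$ has the LP property; (ii) for every $i$, every $x\in S_i$ and every $\varepsilon>0$, there is an integer $j\ge i$ such that $\varphi_{ij}(x)$ can be approximated by an element of $L(A_j)$ to within $\varepsilon$; (iii) for every $i$, there is a spanning set of (the vector space) $A_i$ such that the images of all elements of that spanning set under $\varphi_{i\infty}$ belong to $L(A)$.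
   Context: For a $C^*$-algebra $D$, $L(D)$ denotes the norm closure of the set of all (finite) linear combinations of projections of $D$. $D$ has the LP property if the linear span of its projections is dense in $D$, i.e. $L(D)=D$. For an inductive sequence $(A_i,\varphi_i)$, $\varphi_{ij}\colon A_i\to A_j$ $(j\ge i)$ is the composed connecting map and $\varphi_{i\infty}\colon A_i\to A$ is the canonical map to the limit. Any element $a$ of a $C^*$-algebra $B$ is regarded as an element of $M_n(B)$ via the (non-unital) embedding $a\mapsto\mathrm{diag}(a,0)$; thus $x\in S_{it}\subset B_{it}$ is regarded as the element $\mathrm{diag}(x,0)$ of the summand $M_{n_{it}}(B_{it})$ of $A_i$. *)

(* Defs.v *)
From HB Require Import structures.
From mathcomp Require Import all_boot all_order all_algebra.
From mathcomp Require Import complex.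
From mathcomp Require Import all_classical all_reals all_analysis.

Set Implicit Arguments.
Unset Strict Implicit.
Unset Printing Implicit Defensive.

Import Order.TTheory GRing.Theory Num.Theory.
Import numFieldNormedType.Exports.

Local Open Scope classical_set_scope.
Local Open Scope ring_scope.

(* Associative algebras with involution over the complex numbers R[i]. They
   need not have a unit, so MathComp's ring structures, which are unital, do
   not apply. *)
HB.mixin Record Lmodule_isStarAlgebra (R : realType) V
    of GRing.Lmodule R[i] V := {
  amul : V -> V -> V;
  star : V -> V;
  amulA : associative amul;
  amulDl : left_distributive amul +%R;
  amulDr : right_distributive amul +%R;
  amulZl : forall (a : R[i]) (x y : V), amul (a *: x) y = a *: amul x y;
  amulZr : forall (a : R[i]) (x y : V), amul x (a *: y) = a *: amul x y;
  starK : involutive star;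
  starD : {morph star : x y / x + y};
  starZ : forall (a : R[i]) (x : V), star (a *: x) = a^* *: star x;
  starM : forall x y : V, star (amul x y) = amul (star y) (star x) }.

#[short(type="starAlgType")]
HB.structure Definition StarAlgebra (R : realType) :=
  {V of Lmodule_isStarAlgebra R V & GRing.Lmodule R[i] V}.

Declare Scope star_scope.
Delimit Scope star_scope with star.
Notation "x ** y" := (amul x y) (at level 40, left associativity) : star_scope.
Local Open Scope star_scope.

(* The norm of a normed module over R[i] takes its values in R[i]; they are
   nonnegative, hence real. *)
HB.mixin Record StarAlgebra_isCStar (R : realType) V
    of CompleteNormedModule R[i] V & StarAlgebra R V := {
  normM_le : forall x y : V, `|x ** y| <= `|x| * `|y|;
  norm_cstar : forall x : V, `|star x ** x| = `|x| ^+ 2 }.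

#[short(type="cstarType")]
HB.structure Definition CStar (R : realType) :=
  {V of StarAlgebra_isCStar R V & CompleteNormedModule R[i] V
      & StarAlgebra R V}.

Definition star_hom (R : realType) (U V : starAlgType R) (f : U -> V) : Prop :=
  [/\ linear f, {morph f : x y / x ** y} & {morph f : x / star x}].

Definition self_adjoint (R : realType) (V : starAlgType R) (x : V) : Prop :=
  star x = x.

Definition projection (R : realType) (V : starAlgType R) (p : V) : Prop :=
  star p = p /\ p ** p = p.

Definition linspan (K : nzRingType) (V : lmodType K) (S : set V) : set V :=
  [set v | exists (m : nat) (c : 'I_m -> K) (s : 'I_m -> V),
    (forall l, S (s l)) /\ v = \sum_(l < m) c l *: s l].

Definition spans (K : nzRingType) (V : lmodType K) (S : set V) : Prop :=
  linspan S = setT.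

Definition Lset (R : realType) (D : cstarType R) : set D :=
  closure (linspan (@projection R D)).
Arguments Lset {R} D.

Definition LP_property (R : realType) (D : cstarType R) : Prop :=
  Lset D = setT.

Definition starmx (R : realType) (B : starAlgType R) (n : nat) : Type :=
  'M[B]_n.

Section StarMatrix.
Context {R : realType} (B : starAlgType R) (n : nat).
Implicit Types X Y Z : 'M[B]_n.

Definition starmx_scale (a : R[i]) X : 'M[B]_n := \matrix_(i, j) (a *: X i j).

Definition starmx_mul X Y : 'M[B]_n :=
  \matrix_(i, j) \sum_k (X i k ** Y k j).

Definition starmx_star X : 'M[B]_n := \matrix_(i, j) star (X j i).

Fact amul_suml (I : Type) (r : seq I) (P : pred I) (F : I -> B) (y : B) :
  (\sum_(k <- r | P k) F k) ** y = \sum_(k <- r | P k) (F k ** y).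
Proof.
apply: (big_morph (fun x : B => x ** y)) => [u v|]; first exact: amulDl.
by apply: (addIr (0 ** y)); rewrite -amulDl !add0r.
Qed.

Fact amul_sumr (I : Type) (r : seq I) (P : pred I) (F : I -> B) (x : B) :
  x ** (\sum_(k <- r | P k) F k) = \sum_(k <- r | P k) (x ** F k).
Proof.
apply: (big_morph (fun y : B => x ** y)) => [u v|]; first exact: amulDr.
by apply: (addIr (x ** 0)); rewrite -amulDr !add0r.
Qed.

Fact star_sum (I : Type) (r : seq I) (P : pred I) (F : I -> B) :
  star (\sum_(k <- r | P k) F k) = \sum_(k <- r | P k) star (F k).
Proof.
apply: (big_morph (@star R B)) => [u v|]; first exact: starD.
by apply: (addIr (star (0 : B))); rewrite -starD !add0r.
Qed.

HB.instance Definition _ := GRing.Zmodule.copy (starmx B n) 'M[B]_n.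

Fact starmx_scaleA (a b : R[i]) X :
  starmx_scale a (starmx_scale b X) = starmx_scale (a * b) X.
Proof. by apply/matrixP => i j; rewrite !mxE scalerA. Qed.

Fact starmx_scale1 : left_id 1 starmx_scale.
Proof. by move=> X; apply/matrixP => i j; rewrite !mxE scale1r. Qed.

Fact starmx_scaleDr : right_distributive starmx_scale +%R.
Proof. by move=> a X Y; apply/matrixP => i j; rewrite !mxE scalerDr. Qed.

Fact starmx_scaleDl X : {morph starmx_scale^~ X : a b / a + b}.
Proof. by move=> a b; apply/matrixP => i j; rewrite !mxE scalerDl. Qed.

HB.instance Definition _ := GRing.Zmodule_isLmodule.Build R[i] (starmx B n)
  starmx_scaleA starmx_scale1 starmx_scaleDr starmx_scaleDl.

Fact starmx_mulA : associative starmx_mul.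
Proof.
move=> X Y Z; apply/matrixP => i j; rewrite !mxE.
under eq_bigr do rewrite mxE amul_sumr.
rewrite exchange_big; apply: eq_bigr => k _.
by rewrite mxE amul_suml; apply: eq_bigr => l _; rewrite amulA.
Qed.

Fact starmx_mulDl : left_distributive starmx_mul +%R.
Proof.
move=> X Y Z; apply/matrixP => i j; rewrite !mxE -big_split.
by apply: eq_bigr => k _; rewrite mxE amulDl.
Qed.

Fact starmx_mulDr : right_distributive starmx_mul +%R.
Proof.
move=> X Y Z; apply/matrixP => i j; rewrite !mxE -big_split.
by apply: eq_bigr => k _; rewrite mxE amulDr.
Qed.

Fact starmx_mulZl a X Y :
  starmx_mul (starmx_scale a X) Y = starmx_scale a (starmx_mul X Y).
Proof.
apply/matrixP => i j; rewrite !mxE scaler_sumr.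
by apply: eq_bigr => k _; rewrite mxE amulZl.
Qed.

Fact starmx_mulZr a X Y :
  starmx_mul X (starmx_scale a Y) = starmx_scale a (starmx_mul X Y).
Proof.
apply/matrixP => i j; rewrite !mxE scaler_sumr.
by apply: eq_bigr => k _; rewrite mxE amulZr.
Qed.

Fact starmx_starK : involutive starmx_star.
Proof. by move=> X; apply/matrixP => i j; rewrite !mxE starK. Qed.

Fact starmx_starD : {morph starmx_star : X Y / X + Y}.
Proof. by move=> X Y; apply/matrixP => i j; rewrite !mxE starD. Qed.

Fact starmx_starZ a X :
  starmx_star (starmx_scale a X) = starmx_scale a^* (starmx_star X).
Proof. by apply/matrixP => i j; rewrite !mxE starZ. Qed.

Fact starmx_starM X Y :
  starmx_star (starmx_mul X Y) = starmx_mul (starmx_star Y) (starmx_star X).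
Proof.
apply/matrixP => i j; rewrite !mxE star_sum.
by apply: eq_bigr => k _; rewrite !mxE starM.
Qed.

HB.instance Definition _ := Lmodule_isStarAlgebra.Build R (starmx B n)
  starmx_mulA starmx_mulDl starmx_mulDr starmx_mulZl starmx_mulZr
  starmx_starK starmx_starD starmx_starZ starmx_starM.

(* diag(x, 0); this is 0 when n = 0. *)
Definition corner (x : B) : starmx B n :=
  \matrix_(i, j) (if (i == 0 :> nat) && (j == 0 :> nat) then x else 0).

End StarMatrix.

Definition starsum (R : realType) (k : nat) (M : 'I_k -> starAlgType R) : Type :=
  forall t, M t.

Section StarSum.
Context {R : realType} (k : nat) (M : 'I_k -> starAlgType R).
Implicit Types f g h : starsum M.

HB.instance Definition _ := gen_eqMixin (starsum M).
HB.instance Definition _ := gen_choiceMixin (starsum M).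

Definition starsum0 : starsum M := fun=> 0.
Definition starsum_opp f : starsum M := fun t => - f t.
Definition starsum_add f g : starsum M := fun t => f t + g t.
Definition starsum_scale (a : R[i]) f : starsum M := fun t => a *: f t.
Definition starsum_mul f g : starsum M := fun t => f t ** g t.
Definition starsum_star f : starsum M := fun t => star (f t).

Fact starsum_addA : associative starsum_add.
Proof. by move=> f g h; apply: functional_extensionality_dep => t; exact: addrA. Qed.

Fact starsum_addC : commutative starsum_add.
Proof. by move=> f g; apply: functional_extensionality_dep => t; exact: addrC. Qed.

Fact starsum_add0 : left_id starsum0 starsum_add.
Proof. by move=> f; apply: functional_extensionality_dep => t; exact: add0r. Qed.

Fact starsum_addN : left_inverse starsum0 starsum_opp starsum_add.
Proof. by move=> f; apply: functional_extensionality_dep => t; exact: addNr. Qed.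

HB.instance Definition _ := GRing.isZmodule.Build (starsum M)
  starsum_addA starsum_addC starsum_add0 starsum_addN.

Fact starsum_scaleA (a b : R[i]) f :
  starsum_scale a (starsum_scale b f) = starsum_scale (a * b) f.
Proof. by apply: functional_extensionality_dep => t; exact: scalerA. Qed.

Fact starsum_scale1 : left_id 1 starsum_scale.
Proof. by move=> f; apply: functional_extensionality_dep => t; exact: scale1r. Qed.

Fact starsum_scaleDr : right_distributive starsum_scale +%R.
Proof. by move=> a f g; apply: functional_extensionality_dep => t; exact: scalerDr. Qed.

Fact starsum_scaleDl f : {morph starsum_scale^~ f : a b / a + b}.
Proof. by move=> a b; apply: functional_extensionality_dep => t; exact: scalerDl. Qed.

HB.instance Definition _ := GRing.Zmodule_isLmodule.Build R[i] (starsum M)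
  starsum_scaleA starsum_scale1 starsum_scaleDr starsum_scaleDl.

Fact starsum_mulA : associative starsum_mul.
Proof. by move=> f g h; apply: functional_extensionality_dep => t; exact: amulA. Qed.

Fact starsum_mulDl : left_distributive starsum_mul +%R.
Proof. by move=> f g h; apply: functional_extensionality_dep => t; exact: amulDl. Qed.

Fact starsum_mulDr : right_distributive starsum_mul +%R.
Proof. by move=> f g h; apply: functional_extensionality_dep => t; exact: amulDr. Qed.

Fact starsum_mulZl a f g :
  starsum_mul (starsum_scale a f) g = starsum_scale a (starsum_mul f g).
Proof. by apply: functional_extensionality_dep => t; exact: amulZl. Qed.

Fact starsum_mulZr a f g :
  starsum_mul f (starsum_scale a g) = starsum_scale a (starsum_mul f g).
Proof. by apply: functional_extensionality_dep => t; exact: amulZr. Qed.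

Fact starsum_starK : involutive starsum_star.
Proof. by move=> f; apply: functional_extensionality_dep => t; exact: starK. Qed.

Fact starsum_starD : {morph starsum_star : f g / f + g}.
Proof. by move=> f g; apply: functional_extensionality_dep => t; exact: starD. Qed.

Fact starsum_starZ a f :
  starsum_star (starsum_scale a f) = starsum_scale a^* (starsum_star f).
Proof. by apply: functional_extensionality_dep => t; exact: starZ. Qed.

Fact starsum_starM f g :
  starsum_star (starsum_mul f g) = starsum_mul (starsum_star g) (starsum_star f).
Proof. by apply: functional_extensionality_dep => t; exact: starM. Qed.

HB.instance Definition _ := Lmodule_isStarAlgebra.Build R (starsum M)
  starsum_mulA starsum_mulDl starsum_mulDr starsum_mulZl starsum_mulZr
  starsum_starK starsum_starD starsum_starZ starsum_starM.

Definition summand (t : 'I_k) (x : M t) : starsum M :=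
  fun s => if t =P s is ReflectT e then ecast u (M u) e x else 0.

End StarSum.

(* The *-algebra with underlying set the direct sum of the M_(n t)(B t); a
   C*-algebra *-isomorphic to it is the C*-algebraic direct sum of the matrix
   algebras, since a *-algebra has at most one complete C*-norm. *)
Definition matsum (R : realType) (k : nat) (n : 'I_k -> nat)
    (B : 'I_k -> cstarType R) : starAlgType R :=
  starsum (fun t => starmx (B t) (n t)).

Definition matsum_corner (R : realType) (k : nat) (n : 'I_k -> nat)
    (B : 'I_k -> cstarType R) (t : 'I_k) (x : B t) : matsum n B :=
  summand (corner (n t) x : starmx (B t) (n t)).

Definition star_iso (R : realType) (U V : starAlgType R) (f : U -> V) : Prop :=
  star_hom f /\ bijective f.

(* The connecting map A_i -> A_j for j = d + i. *)
Fixpoint connecting (R : realType) (A : nat -> cstarType R)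
    (phi : forall i, A i -> A i.+1) (i d : nat) : A i -> A (d + i)%N :=
  match d return A i -> A (d + i)%N with
  | 0%N => id
  | d'.+1 => fun x => phi (d' + i)%N (connecting phi d' x)
  end.

(* The inductive limit is the Hausdorff completion of the algebraic direct
   limit for the seminorm that sends the class of x in A_i to the limit of the
   norms of its images in the A_j. Spelled out: the canonical maps psi i are
   compatible *-homomorphisms, they carry that seminorm to the norm of L, and
   their images have dense union in the complete space L. *)
Record is_inductive_limit (R : realType) (A : nat -> cstarType R)
    (phi : forall i, A i -> A i.+1) (L : cstarType R)
    (psi : forall i, A i -> L) : Prop := {
  lim_hom : forall i, star_hom (psi i);
  lim_compat : forall i x, psi i.+1 (phi i x) = psi i x;
  lim_norm : forall i x,
    (`|connecting phi d x| : R[i]^o) @[d --> \oo] --> (`|psi i x| : R[i]^o);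
  lim_dense : closure (\bigcup_i range (psi i)) = setT }.

(* Main.v *)
(* Everything rests on one construction: for self-adjoint [a] with norm < 1, the
   fixed point [c] of [c = (a^2 + c^2) / 2] is [1 - sqrt (1 - a^2)], so that
   [1 - c + i a] acts as a unitary. Since *-homomorphisms preserve the relation
   between [a] and [c], they are contractive; conjugating projections by these
   unitaries for small [a] shows that [L(D)] is a closed Lie ideal of [D].
   (i) => (ii): projections of the limit are almost projections at a finite
   stage, and Newton's iteration turns these into projections.
   (ii) => (i): the (0,0) matrix units of each summand are sent into [L(A)], and
   the other ones are commutators with them, up to the density in [B] of sums
   of products, so all of [A_i] is sent into [L(A)]. *)
From HB Require Import structures.
Require Import Defs.
From mathcomp Require Import all_boot all_order all_algebra.
From mathcomp Require Import complex.
From mathcomp Require Import all_classical all_reals all_analysis.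
From mathcomp Require Import ring lra.

Set Implicit Arguments.
Unset Strict Implicit.
Unset Printing Implicit Defensive.

Import Order.TTheory GRing.Theory Num.Theory.
Import numFieldNormedType.Exports.
Local Open Scope classical_set_scope.
Local Open Scope ring_scope.
Local Open Scope complex_scope.
Local Open Scope star_scope.

(* Locked, lest unification should try to decide [im = halfc] by computation. *)
Definition im {R : realType} : R[i] := locked (0 +i* 1).
Definition halfc {R : realType} : R[i] := locked (2^-1)%:C.

(* Identities between linear combinations in [V] become identities in the
   commutative ring [K + V] with [V * V = 0], where [ring] applies. *)
Section SquareZeroExtension.
Context {K : comNzRingType} (V : lmodType K).

Definition sqzero : Type := (K * V)%type.

HB.instance Definition _ := GRing.Zmodule.copy sqzero (K * V)%type.

Definition sqzero_mul (x y : sqzero) : sqzero :=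
  (x.1 * y.1, x.1 *: y.2 + y.1 *: x.2).

Fact sqzero_mulA : associative sqzero_mul.
Proof.
move=> [a x] [b y] [c z]; congr pair => /=; first exact: mulrA.
by rewrite !scalerDr !scalerA addrA mulrC [c * b]mulrC (mulrC b a) (mulrC c a).
Qed.

Fact sqzero_mulC : commutative sqzero_mul.
Proof. by move=> [a x] [b y]; congr pair; [exact: mulrC | exact: addrC]. Qed.

Fact sqzero_mul1 : left_id (1, 0) sqzero_mul.
Proof. by move=> [a x]; congr pair; rewrite /= ?mul1r // scale1r scaler0 addr0. Qed.

Fact sqzero_mulDl : left_distributive sqzero_mul +%R.
Proof.
move=> [a x] [b y] [c z]; congr pair => /=; first exact: mulrDl.
by rewrite scalerDl scalerDr addrACA.
Qed.

Fact sqzero_1neq0 : (1, 0) != 0 :> sqzero.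
Proof. by apply/eqP => -[] /eqP; rewrite oner_eq0. Qed.

HB.instance Definition _ := GRing.Zmodule_isComNzRing.Build sqzero
  sqzero_mulA sqzero_mulC sqzero_mul1 sqzero_mulDl sqzero_1neq0.

Definition sqzero_scalar (a : K) : sqzero := (a, 0).
Definition sqzero_vec (x : V) : sqzero := (0, x).

Lemma sqzero_vec0 : sqzero_vec 0 = 0. Proof. by []. Qed.

Lemma sqzero_vecN x : sqzero_vec (- x) = - sqzero_vec x.
Proof. by congr pair; rewrite /= oppr0. Qed.

Lemma sqzero_vecD x y : sqzero_vec (x + y) = sqzero_vec x + sqzero_vec y.
Proof. by congr pair; rewrite /= addr0. Qed.

Lemma sqzero_vecZ a x : sqzero_vec (a *: x) = sqzero_scalar a * sqzero_vec x.
Proof. by congr pair; rewrite /= ?mulr0 // scale0r addr0. Qed.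

Lemma sqzero_vec_inj : injective sqzero_vec.
Proof. by move=> x y []. Qed.

End SquareZeroExtension.

(* The scalars are generalized because [ring] would try to evaluate them. *)
Ltac module :=
  apply: sqzero_vec_inj;
  rewrite ?(sqzero_vec0, sqzero_vecD, sqzero_vecN, sqzero_vecZ);
  repeat match goal with
  | |- context [@sqzero_scalar ?K ?V ?a] =>
      generalize (@sqzero_scalar K V a); intro
  | |- context [@sqzero_vec ?K ?V ?x] => generalize (@sqzero_vec K V x); intro
  end; ring.

(** * Scalars and geometric decay *)

Local Notation normc := ComplexField.Normc.normc.

Lemma im_sqr (R : realType) : im * im = -1 :> R[i].
Proof. by rewrite /im -lock -sqr_i expr2. Qed.

Lemma im_conj (R : realType) : im^* = - im :> R[i].
Proof. by rewrite /im -lock; apply/eqP; rewrite eq_complex /= oppr0 !eqxx. Qed.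

Lemma halfcD (R : realType) : halfc + halfc = 1 :> R[i].
Proof.
rewrite /halfc -lock -rmorphD -(rmorph1 (real_complex R)); congr (_%:C); lra.
Qed.

(** Induction bounds [D n] by [D 0 * r ^ n], which tends to 0. *)
Lemma geometric_small (R : realType) (D : nat -> R) (r eps : R) :
  0 <= r < 1 -> (forall n, D n.+1 <= r * D n) -> 0 < eps ->
  exists N, forall n, (N <= n)%N -> D n < eps.
Proof.
move=> /andP[r0 r1] Dr e0.
have le_geo n : D n <= geometric (D 0%N) r n.
  elim: n => [|n IHn]; first by rewrite /= expr0 mulr1.
  apply: (le_trans (Dr n)).
  by rewrite /= exprS mulrCA; apply: ler_wpM2l.
have /cvgrPdist_lt/(_ _ e0)[N _ NP] : geometric (D 0%N) r @ \oo --> 0.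
  by apply: cvg_geometric; rewrite ger0_norm.
exists N => n Nn; apply: (le_lt_trans (le_geo n)).
by have := NP n Nn; rewrite /= sub0r normrN; apply: le_lt_trans; exact: ler_norm.
Qed.

(** * Real-valued norms and limits of geometrically convergent iterations *)

(* Sums and scalings in a C*-algebra [D] are always those of the underlying
   *-algebra: terms built from the other, merely convertible, instances would
   not match syntactically. *)
Section RealNorm.
Context {R : realType} {D : cstarType R}.
Local Notation V := (D : starAlgType R).
Implicit Types x y : V.

(** Taking the real part turns norm estimates into inequalities over [R], where [lra] and [nra]
    apply. *)
Definition nrm x : R := complex.Re `|x : D|.

Lemma nrmE x : `|x : D| = (nrm x)%:C.
Proof. by rewrite RRe_real // normr_real. Qed.

Lemma nrm_ge0 x : 0 <= nrm x.
Proof. by rewrite -lecR -nrmE normr_ge0. Qed.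

Lemma nrm0 : nrm (0 : V) = 0.
Proof. by rewrite /nrm [LHS](congr1 _ (@normr0 _ D)). Qed.

Lemma nrm_eq0 x : nrm x = 0 -> x = 0.
Proof. by move=> x0; apply/(@normr0_eq0 _ D); rewrite nrmE x0. Qed.

Lemma nrmN x : nrm (- x) = nrm x.
Proof. exact: congr1 (@normrN _ D x). Qed.

Lemma nrmBC x y : nrm (x - y) = nrm (y - x).
Proof. exact: congr1 (@distrC _ D x y). Qed.

Lemma nrmD x y : nrm (x + y) <= nrm x + nrm y.
Proof. by rewrite -lecR rmorphD /= -!nrmE; exact: (@ler_normD _ D). Qed.

Lemma nrmB x y : nrm (x - y) <= nrm x + nrm y.
Proof. by rewrite -(nrmN y) nrmD. Qed.

(** Lets an identity pass to the limit of an iteration: its defect only has to be bounded by a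
    multiple of the error bound [d n], which tends to 0. *)
Lemma eq0_geometric (d : nat -> R) (r K : R) x :
  0 <= r < 1 -> (forall n, d n.+1 <= r * d n) -> (forall n, 0 <= d n) ->
  (forall n, nrm x <= K * d n) -> x = 0.
Proof.
move=> r01 dr d0 xd; apply/nrm_eq0/eqP; rewrite eq_le nrm_ge0 andbT.
apply/ler_addgt0Pr => e e0; rewrite add0r.
have K1 : 0 < `|K| + 1 by rewrite ltr_wpDl.
have [N /(_ N (leqnn N)) dN] := geometric_small r01 dr (divr_gt0 e0 K1).
have := xd N; move: dN; rewrite ltr_pdivlMr //.
by have := d0 N; have := ler_norm K; nra.
Qed.

Lemma nrmZ (a : R[i]) x : nrm (a *: x) = normc a * nrm x.
Proof.
rewrite /nrm (@normrZ _ D a x : `|_ : D| = _) (nrmE x) normc_def /=.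
by rewrite mul0r subr0; case: a.
Qed.

Lemma normc_real (t : R) : normc t%:C = `|t|.
Proof. by rewrite /= expr0n addr0 sqrtr_sqr. Qed.

Lemma normc_im : normc (im : R[i]) = 1.
Proof. by rewrite /im -lock /= expr0n expr1n add0r sqrtr1. Qed.

Lemma normc_ge0 (a : R[i]) : 0 <= normc a.
Proof. by case: a => a b; rewrite /= sqrtr_ge0. Qed.

Lemma nrmZ_real (t : R) x : nrm (t%:C *: x) = `|t| * nrm x.
Proof. by rewrite nrmZ normc_real. Qed.

Lemma nrm_im x : nrm (im *: x) = nrm x.
Proof. by rewrite nrmZ normc_im mul1r. Qed.

Lemma nrm_half x : nrm (halfc *: x) = nrm x / 2.
Proof. by rewrite /halfc -lock nrmZ_real ger0_norm ?invr_ge0 // mulrC. Qed.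

Lemma nrm_double x : nrm (x + x) = 2 * nrm x.
Proof.
have <- : (2 : R)%:C *: x = x + x by rewrite rmorph_nat scaler_nat mulr2n.
by rewrite nrmZ_real ger0_norm.
Qed.

Lemma closureP (S : set D) (x : D) :
  closure S x <-> forall eps : R, 0 < eps ->
    exists y : V, S y /\ nrm ((x : V) - y) < eps.
Proof.
split=> [Sx eps e0|Sx].
  have /Sx[y [Sy]] : nbhs x (ball x eps%:C) by apply: nbhsx_ballx; rewrite ltcR.
  by rewrite -ball_normE /ball_ /= (nrmE (_ - _)) ltcR => xy; exists y.
move=> U /nbhs_ballP[e /= e0 eU].
have ee : e = (complex.Re e)%:C by rewrite RRe_real // gtr0_real.
have /Sx[y [Sy xy]] : 0 < complex.Re e by rewrite -ltcR -ee.
exists y; split=> //; apply: eU.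
by rewrite -ball_normE /ball_ /= (nrmE (_ - _)) ee ltcR.
Qed.

(** The increments telescope to [nrm (u (n + m) - u n) <= d n - d (n + m)], so [u] is Cauchy and [d]
    is also an explicit error bound. *)
Lemma geometric_limit (u : nat -> V) (d : nat -> R) (r : R) :
  0 <= r < 1 -> (forall n, d n.+1 <= r * d n) -> (forall n, 0 <= d n) ->
  (forall n, nrm (u n.+1 - u n) <= d n - d n.+1) ->
  exists l : V, forall n, nrm (l - u n) <= d n.
Proof.
move=> r01 dr d0 ud.
have udm n m : nrm (u (n + m)%N - u n) <= d n - d (n + m)%N.
  elim: m => [|m IHm]; first by rewrite addn0 !subrr nrm0.
  rewrite addnS -(subrK (u (n + m)%N) (u _.+1)) -addrA.
  by apply: (le_trans (nrmD _ _)); have := ud (n + m)%N; lra.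
have /cvg_ex[/= l ul] : cvg ((u : nat -> D) @ \oo).
  apply/cauchy_cvgP/cauchy_exP => e /= e0.
  have ee : e = (complex.Re e)%:C by rewrite RRe_real // gtr0_real.
  have Re0 : 0 < complex.Re e by rewrite -ltcR -ee.
  have [N NP] := geometric_small r01 dr Re0.
  exists (u N); exists N => // n /= Nn.
  rewrite -ball_normE /ball_ /= (nrmE (_ - _)) ee ltcR nrmBC -(subnKC Nn).
  by have := udm N (n - N)%N; have := NP N (leqnn N); have := d0 (N + (n - N))%N; lra.
exists l => n; apply/ler_addgt0Pr => e e0.
have /cvgrPdist_lt/(_ e%:C)[|N _ NP] := ul; first by rewrite ltcR.
have := NP (n + N)%N (leq_addl _ _); rewrite /= (nrmE (_ - _)) ltcR => luN.
rewrite -(subrK (u (n + N)%N) l) -addrA.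
apply: (le_trans (nrmD _ _)).
by have := udm n N; have := d0 (n + N)%N; lra.
Qed.

End RealNorm.

(** * Algebraic identities for the unitaries [1 - c + i a] *)

Section StarAlgebraTheory.
Context {R : realType} {D : starAlgType R}.
Implicit Types a c x y z : D.

Lemma amul0l x : 0 ** x = 0.
Proof. by rewrite -(scale0r (0 : D)) amulZl !scale0r. Qed.

Lemma amul0r x : x ** 0 = 0.
Proof. by rewrite -(scale0r (0 : D)) amulZr !scale0r. Qed.

Lemma amulNl x y : (- x) ** y = - (x ** y).
Proof. by rewrite -scaleN1r amulZl scaleN1r. Qed.

Lemma amulNr x y : x ** (- y) = - (x ** y).
Proof. by rewrite -scaleN1r amulZr scaleN1r. Qed.

Lemma star_real (t : R) x : star (t%:C *: x) = t%:C *: star x.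
Proof. by rewrite starZ; congr (_ *: _); exact: conjc_real. Qed.

Lemma star_im x : star (im *: x) = - (im *: star x).
Proof. by rewrite starZ -scaleNr; congr (_ *: _); exact: im_conj. Qed.

Lemma star_half x : star (halfc *: x) = halfc *: star x.
Proof. by rewrite /halfc -lock star_real. Qed.

Lemma star0 : star (0 : D) = 0.
Proof. by apply: (addIr (star 0)); rewrite -starD !add0r. Qed.

Lemma starN x : star (- x) = - star x.
Proof. by apply: (addrI (star x)); rewrite -starD !subrr star0. Qed.

Definition amulE := (@amulDl R D, @amulDr R D, amulNl, amulNr,
  @amulZl R D, @amulZr R D, @amulA R D).
Definition starE := (@starD R D, starN, star_im, star_half, @starM R D).

Lemma scale_im_im x : im *: (im *: x) = - x.
Proof. by rewrite scalerA im_sqr scaleN1r. Qed.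

Lemma scale_half x : halfc *: (x + x) = x.
Proof. by rewrite scalerDr -scalerDl halfcD scale1r. Qed.

Lemma cartesian x :
  exists h k, [/\ self_adjoint h, self_adjoint k & x = h + im *: k].
Proof.
exists (halfc *: (x + star x)), (- (halfc *: (im *: (x - star x)))).
split.
- by rewrite /self_adjoint !starE starK addrC.
- by rewrite /self_adjoint !starE starK; module.
rewrite scalerN !scalerA mulrC -!scalerA scale_im_im -[LHS]scale_half; module.
Qed.

(* [c] stands for [1 - sqrt (1 - a ^ 2)] in the unitization. *)
Definition circle (a c : D) :=
  [/\ self_adjoint a, self_adjoint c, a ** c = c ** a
    & a ** a + c ** c = c + c].

(** Left multiplication by [1 - c + i a] and, next, right multiplication by its adjoint
    [1 - c - i a]; they are maps on [D] because [D] may lack a unit. *)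
Definition rotL (a c y : D) := y - c ** y + im *: (a ** y).
Definition rotR (a c y : D) := y - y ** c - im *: (y ** a).

Lemma circleN a c : circle a c -> circle (- a) c.
Proof.
by move=> [sa sc ac E]; split; rewrite // /self_adjoint ?starN ?sa // !amulE ?ac // opprK.
Qed.

(** Since [a] and [c] commute, [(1 - c - i a) (1 - c + i a) = (1 - c)^2 + a^2], which is 1 by the
    last relation of [circle]. *)
Lemma rotLNK a c y : circle a c -> rotL (- a) c (rotL a c y) = y.
Proof.
move=> [_ _ ac E]; rewrite /rotL !amulE !(scalerN, scalerDr).
have -> : im *: (im *: (a ** a ** y)) = c ** c ** y - c ** y - c ** y.
  by rewrite scale_im_im -[a ** a](addrK (c ** c)) E !amulE; module.
rewrite ac; module.
Qed.

Lemma rotLK a c y : circle a c -> rotL a c (rotL (- a) c y) = y.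
Proof. by move=> /circleN/rotLNK; rewrite opprK; apply. Qed.

(** With [z = rotL a c y], so that [y = rotL (- a) c z], the claim becomes
    [rotR a c x ** z = x ** rotL (- a) c z], which is associativity. *)
Lemma rotRL a c x y : circle a c -> rotR a c x ** rotL a c y = x ** y.
Proof.
move=> cac; rewrite -[in RHS](rotLNK y cac).
by rewrite /rotR /rotL; set z := y - _ + _; rewrite !amulE; module.
Qed.

Lemma star_rotL a c y : circle a c -> star (rotL a c y) = rotR a c (star y).
Proof. by move=> [sa sc _ _]; rewrite /rotL /rotR !starE sa sc. Qed.

Lemma circle_step_comm a z : a ** z = z ** a ->
  a ** (halfc *: (a ** a + z ** z)) = halfc *: (a ** a + z ** z) ** a.
Proof. by move=> az; rewrite !amulE az -[z ** a ** z]amulA az amulA. Qed.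

Lemma circle_stepB b x y :
  halfc *: (b + x ** x) - halfc *: (b + y ** y) =
  halfc *: (x ** (x - y) + (x - y) ** y).
Proof. rewrite amulDl amulDr amulNl amulNr; module. Qed.

(** Here and in [commBB] and [circleBB], the defect of a relation at [c] is expressed through the
    error [c - z] of an iterate [z]; [circleBB] also involves the next iterate [w]. *)
Lemma starBB c z : star z = z -> star c - c = star (c - z) - (c - z).
Proof. by move=> zz; rewrite starD starN zz; module. Qed.

Lemma commBB a c z : a ** z = z ** a ->
  a ** c - c ** a = a ** (c - z) - (c - z) ** a.
Proof. by move=> az; rewrite !amulE az; module. Qed.

Lemma circleBB a c w z : a ** a + z ** z = w + w ->
  a ** a + c ** c - (c + c) =
  c ** (c - z) + (c - z) ** z - ((c - w) + (c - w)).
Proof. by move=> E; rewrite -[a ** a](addrK (z ** z)) E !amulE; module. Qed.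

Lemma rotLB a c y :
  rotL a c y - rotL (- a) c y = im *: (a ** y + a ** y).
Proof. by rewrite /rotL amulNl; module. Qed.

End StarAlgebraTheory.

(** * The C*-norm and the existence of circle pairs *)

Section CStarTheory.
Context {R : realType} {D : cstarType R}.
Local Notation A := (D : starAlgType R).
Implicit Types a c x y z : A.

Lemma nrmM x y : nrm (x ** y) <= nrm x * nrm y.
Proof. by rewrite -lecR rmorphM /= -!nrmE (normM_le (x : D)). Qed.

Lemma nrm_cstar x : nrm (star x ** x) = nrm x ^+ 2.
Proof. by apply: (@complexI R); rewrite rmorphXn /= -!nrmE (norm_cstar (x : D)). Qed.

Lemma nrm_star x : nrm (star x) = nrm x.
Proof.
have le_star y : nrm y <= nrm (star y).
  have := nrmM (star y) y; rewrite nrm_cstar expr2.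
  have [->|y0] := eqVneq (nrm y) 0; first by rewrite nrm_ge0.
  by rewrite ler_pM2r // lt_def y0 nrm_ge0.
by apply/eqP; rewrite eq_le le_star andbT -[leRHS](congr1 nrm (starK x)) le_star.
Qed.

Lemma nrm_sqr x : self_adjoint x -> nrm (x ** x) = nrm x ^+ 2.
Proof. by move=> sx; rewrite -nrm_cstar sx. Qed.

(** Testing on [y = star z] suffices, as the C*-identity gives [z ** star z] the norm
    [nrm z ^+ 2]. *)
Lemma nrm_le1 z : (forall y, nrm (z ** y) <= nrm y) -> nrm z <= 1.
Proof.
move=> /(_ (star z)); rewrite nrm_star.
have := nrm_cstar (star z); rewrite starK nrm_star => -> z2.
have [->|z0] := eqVneq (nrm z) 0; first exact: ler01.
by rewrite -(@ler_pM2r _ (nrm z)) ?mul1r -?expr2 // lt_def z0 nrm_ge0.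
Qed.

Lemma nrm_rotL a c y : circle a c -> nrm (rotL a c y) = nrm y.
Proof.
move=> cac; apply/eqP; rewrite -(@eqrXn2 _ 2%N) ?nrm_ge0 //.
by rewrite -!nrm_cstar star_rotL // rotRL.
Qed.

Lemma nrm_rotR a c y : circle a c -> nrm (rotR a c y) = nrm y.
Proof.
move=> cac; rewrite -nrm_star -(starK y) -star_rotL // starK nrm_rotL //.
by rewrite starK nrm_star.
Qed.

(** Left multiplication by [2 i a] is the difference of the isometries [rotL a c] and
    [rotL (- a) c]. *)
Lemma circle_nrm_le1 a c : circle a c -> nrm a <= 1.
Proof.
move=> cac; apply: nrm_le1 => y.
have := nrmB (rotL a c y) (rotL (- a) c y).
by rewrite rotLB nrm_im nrm_double !nrm_rotL //; [lra | exact: circleN].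
Qed.

(** Started at 0, the iteration stays in the ball of radius [s = nrm a ^+ 2], as
    [(s + s^2) / 2 <= s], and there it contracts distances by the factor [s < 1]. *)
Lemma circle_exists a : self_adjoint a -> nrm a < 1 ->
  exists c, circle a c /\ nrm c <= nrm a ^+ 2.
Proof.
move=> sa a1; pose s := nrm a ^+ 2.
have s0 : 0 <= s by rewrite sqr_ge0.
have s1 : s < 1 by rewrite expr_lt1 ?nrm_ge0.
have [c_ [c_0 c_E]] : exists c_ : nat -> A, c_ 0%N = 0 /\
    forall n, c_ n.+1 = halfc *: (a ** a + c_ n ** c_ n).
  by exists (fix c_ n := if n is m.+1 then
    halfc *: (a ** a + c_ m ** c_ m) else 0).
have c_S n : a ** a + c_ n ** c_ n = c_ n.+1 + c_ n.+1.
  by rewrite c_E -scalerDr scale_half.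
have c_s n : nrm (c_ n) <= s.
  elim: n => [|n IHn]; first by rewrite c_0 nrm0.
  rewrite c_E nrm_half.
  have := nrmD (a ** a) (c_ n ** c_ n); rewrite nrm_sqr // -/s.
  by have := nrmM (c_ n) (c_ n); have := nrm_ge0 (c_ n); nra.
have c_sa n : self_adjoint (c_ n).
  rewrite /self_adjoint; elim: n => [|n IHn]; first by rewrite c_0 star0.
  by rewrite c_E !starE IHn sa.
have c_comm n : a ** c_ n = c_ n ** a.
  elim: n => [|n IHn]; first by rewrite c_0 amul0l amul0r.
  by rewrite c_E circle_step_comm.
(* The sum of the geometric series that dominates all increments from [n] on. *)
pose D_ n := nrm (c_ n.+1 - c_ n) / (1 - s).
have D_ge0 n : 0 <= D_ n by rewrite divr_ge0 ?nrm_ge0 // subr_ge0 ltW.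
have D_S n : D_ n.+1 <= s * D_ n.
  rewrite mulrA; apply: ler_wpM2r; first by rewrite invr_ge0 subr_ge0 ltW.
  have -> : c_ n.+2 - c_ n.+1 = halfc *:
      (c_ n.+1 ** (c_ n.+1 - c_ n) + (c_ n.+1 - c_ n) ** c_ n).
    by rewrite -(circle_stepB (a ** a)) -!c_E.
  rewrite nrm_half.
  have := nrm_ge0 (c_ n.+1 - c_ n); set d := c_ n.+1 - c_ n => d0.
  have := nrmD (c_ n.+1 ** d) (d ** c_ n).
  have := nrmM (c_ n.+1) d; have := nrmM d (c_ n).
  have := ler_wpM2r d0 (c_s n.+1); have := ler_wpM2l d0 (c_s n).
  lra.
have s01 : 0 <= s < 1 by rewrite s0.
have D_step n : nrm (c_ n.+1 - c_ n) <= D_ n - D_ n.+1.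
  have := D_S n; have -> : nrm (c_ n.+1 - c_ n) = D_ n * (1 - s).
    by rewrite /D_ mulfVK // gt_eqF // subr_gt0.
  lra.
have [c cD] := geometric_limit s01 D_S D_ge0 D_step.
have lim0 (x : A) K := @eq0_geometric _ _ _ _ K x s01 D_S D_ge0.
exists c; split; last first.
  apply/ler_addgt0Pr => e e0.
  have [N /(_ N (leqnn N)) DN] := geometric_small s01 D_S e0.
  have := nrmD (c - c_ N) (c_ N); rewrite subrK.
  by have := cD N; have := c_s N; rewrite -/s; lra.
split=> //.
- apply/eqP; rewrite -subr_eq0; apply/eqP/(lim0 _ 2) => n.
  rewrite (starBB _ (c_sa n)).
  by apply: (le_trans (nrmB _ _)); rewrite nrm_star; have := cD n; lra.
- apply/eqP; rewrite -subr_eq0; apply/eqP/(lim0 _ (2 * nrm a)) => n.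
  rewrite (commBB _ (c_comm n)).
  apply: (le_trans (nrmB _ _)).
  have := nrmM a (c - c_ n); have := nrmM (c - c_ n) a.
  by have := cD n; have := nrm_ge0 a; nra.
- apply/eqP; rewrite -subr_eq0; apply/eqP/(lim0 _ (nrm c + s + 2)) => n.
  rewrite (circleBB c (c_S n)).
  apply: (le_trans (nrmB _ _)).
  have := nrmD (c ** (c - c_ n)) ((c - c_ n) ** c_ n).
  have := nrmD (c - c_ n.+1) (c - c_ n.+1).
  have := nrmM c (c - c_ n); have := nrmM (c - c_ n) (c_ n).
  have := cD n; have := cD n.+1; have := nrm_ge0 c; have := c_s n.
  by have := nrm_ge0 (c - c_ n); have := D_S n; have := D_ge0 n; nra.
Qed.

End CStarTheory.

(** * Star-homomorphisms and their contractivity *)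

Section StarHom.
Context {R : realType} {U V : starAlgType R} (f : U -> V).
Context (f_hom : star_hom f).

Lemma star_homD x y : f (x + y) = f x + f y.
Proof. by case: f_hom => f_lin _ _; rewrite -[x]scale1r f_lin !scale1r. Qed.

Lemma star_hom0 : f 0 = 0.
Proof. by apply: (addIr (f 0)); rewrite -star_homD !add0r. Qed.

Lemma star_homZ a x : f (a *: x) = a *: f x.
Proof.
case: f_hom => f_lin _ _.
by rewrite -[LHS](congr1 f (addr0 _)) f_lin star_hom0 addr0.
Qed.

Lemma star_homN x : f (- x) = - f x.
Proof. by rewrite -scaleN1r star_homZ scaleN1r. Qed.

Lemma star_homB x y : f (x - y) = f x - f y.
Proof. by rewrite star_homD star_homN. Qed.

Lemma star_homM x y : f (x ** y) = f x ** f y.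
Proof. by case: f_hom => _ f_mul _; exact: f_mul. Qed.

Lemma star_hom_star x : f (star x) = star (f x).
Proof. by case: f_hom => _ _ f_star; exact: f_star. Qed.

Lemma star_hom_sum (I : Type) (r : seq I) (P : pred I) (F : I -> U) :
  f (\sum_(i <- r | P i) F i) = \sum_(i <- r | P i) f (F i).
Proof. exact: (big_morph f star_homD star_hom0). Qed.

Lemma star_hom_sa x : self_adjoint x -> self_adjoint (f x).
Proof. by move=> sx; rewrite /self_adjoint -star_hom_star sx. Qed.

Lemma star_hom_projection p : projection p -> projection (f p).
Proof. by move=> [sp pp]; split; rewrite -?star_hom_star -?star_homM ?sp ?pp. Qed.

Lemma star_hom_circle a c : circle a c -> circle (f a) (f c).
Proof.
move=> [sa sc ac E]; split; rewrite -?star_homM -?star_homD ?ac ?E //.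
- exact: star_hom_sa.
- exact: star_hom_sa.
Qed.

End StarHom.

Lemma star_hom_comp (R : realType) (U V W : starAlgType R) (f : U -> V)
  (g : V -> W) : star_hom f -> star_hom g -> star_hom (g \o f).
Proof.
move=> hf hg; split=> [a x y|x y|x] /=.
- by rewrite (star_homD hf) (star_homZ hf) (star_homD hg) (star_homZ hg).
- by rewrite (star_homM hf) (star_homM hg).
- by rewrite (star_hom_star hf) (star_hom_star hg).
Qed.

(** If [nrm x < 1], then [star x ** x] belongs to a circle pair; so does its image, whose norm is
    therefore at most 1. Scaling does the rest. *)
Lemma star_hom_contractive (R : realType) (D E : cstarType R)
    (f : (D : starAlgType R) -> (E : starAlgType R)) :
  star_hom f -> forall x : (D : starAlgType R), nrm (f x) <= nrm x.
Proof.
move=> f_hom.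
have unit_ball (x : (D : starAlgType R)) : nrm x < 1 -> nrm (f x) <= 1.
  move=> x1; have xx1 : nrm (star x ** x) < 1 by rewrite nrm_cstar expr_lt1 ?nrm_ge0.
  have [|c [cac _]] := circle_exists _ xx1; first by rewrite /self_adjoint !starE starK.
  have := circle_nrm_le1 (star_hom_circle f_hom cac).
  by rewrite (star_homM f_hom) (star_hom_star f_hom) nrm_cstar expr_le1 // nrm_ge0.
move=> x; apply/ler_addgt0Pr => e e0.
(* Dividing by [nrm x + e] brings the norm strictly below 1, also when [x = 0]. *)
have t0 : 0 < nrm x + e by rewrite ltr_wpDl // nrm_ge0.
have := unit_ball ((nrm x + e)^-1%:C *: x).
rewrite (star_homZ f_hom) !nrmZ_real ger0_norm ?invr_ge0 ?(ltW t0) //.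
by rewrite !(mulrC (_ ^-1)) ltr_pdivrMr // ler_pdivrMr // !mul1r ltrDl; apply.
Qed.

(** * Subspaces and linear spans *)

Section Subspace.
Context {K : nzRingType} {V : lmodType K}.
Implicit Types W S : set V.

Definition lin_subspace W := W 0 /\ forall a x y, W x -> W y -> W (a *: x + y).

Lemma subspaceD W x y : lin_subspace W -> W x -> W y -> W (x + y).
Proof. by move=> [_ sW] Wx Wy; rewrite -[x]scale1r; exact: sW. Qed.

Lemma subspaceZ W a x : lin_subspace W -> W x -> W (a *: x).
Proof. by move=> [W0 sW] Wx; rewrite -[_ *: _]addr0; exact: sW. Qed.

Lemma subspaceN W x : lin_subspace W -> W x -> W (- x).
Proof. by move=> sW; rewrite -scaleN1r; exact: subspaceZ. Qed.

Lemma subspaceB W x y : lin_subspace W -> W x -> W y -> W (x - y).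
Proof. by move=> sW Wx Wy; apply: subspaceD => //; exact: subspaceN. Qed.

Lemma subspace_sum W (I : Type) (r : seq I) (F : I -> V) :
  lin_subspace W -> (forall i, W (F i)) -> W (\sum_(i <- r) F i).
Proof.
move=> sW WF; elim/big_rec: _ => [|i x _]; first by case: sW.
exact: subspaceD.
Qed.

(** Serves as the induction principle for linear spans. *)
Lemma linspan_min S W : lin_subspace W -> S `<=` W -> linspan S `<=` W.
Proof.
move=> sW SW _ [m [c [s [Ss ->]]]]; apply: subspace_sum => // l.
by apply: subspaceZ => //; exact: SW.
Qed.

Lemma sub_linspan S : S `<=` linspan S.
Proof.
by move=> x Sx; exists 1%N, (fun=> 1), (fun=> x); rewrite big_ord1 scale1r.
Qed.

Lemma linspan_subspace S : lin_subspace (linspan S).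
Proof.
split; first by exists 0%N, (fun=> 0), (fun=> 0); split; [case | rewrite big_ord0].
move=> a _ _ [m [c [s [Ss ->]]]] [n [d [t [St ->]]]].
exists (m + n)%N,
  (fun l => match fintype.split l with inl i => a * c i | inr j => d j end),
  (fun l => match fintype.split l with inl i => s i | inr j => t j end).
split=> [l|]; first by case: fintype.split.
rewrite big_split_ord /= scaler_sumr; congr (_ + _); apply: eq_bigr => i _.
  by rewrite (unsplitK (inl i)) scalerA.
by rewrite (unsplitK (inr i)).
Qed.

End Subspace.

(** * The closed span of the projections is a Lie ideal *)

Section LieIdeal.
Context {R : realType}.

Section Rotation.
Context {D : starAlgType R}.
Implicit Types a c x y p : D.

Lemma rotLM a c x y : rotL a c x ** y = rotL a c (x ** y).
Proof. by rewrite /rotL !amulE. Qed.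

Lemma rotRM a c x y : x ** rotR a c y = rotR a c (x ** y).
Proof. by rewrite /rotR !amulE. Qed.

Lemma rotLR a c x : rotL a c (rotR a c x) = rotR a c (rotL a c x).
Proof. by rewrite /rotL /rotR !amulE; module. Qed.

Lemma star_rotR a c x : circle a c -> star (rotR a c x) = rotL a c (star x).
Proof. by move=> cac; rewrite -[x in LHS]starK -star_rotL // starK. Qed.

Lemma rot_projection a c p : circle a c -> projection p ->
  projection (rotL a c (rotR a c p)).
Proof.
move=> cac [sp pp]; split.
  by rewrite star_rotL // star_rotR // sp rotLR.
by rewrite [X in X ** _]rotLR rotRL // rotLM rotRM pp.
Qed.

(** Every term on the right contains [c] or two factors [a]. As [circle_exists] makes [c] quadratic
    in [a], conjugation moves [p] by [i (a p - p a)] up to second order. *)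
Lemma rot_defect a c p :
  rotL a c (rotR a c p) - p - im *: (a ** p - p ** a) =
  im *: (a ** (- (p ** c) - im *: (p ** a))) - c ** rotR a c p - p ** c.
Proof.
have -> : - (p ** c) - im *: (p ** a) = rotR a c p - p by rewrite /rotR; module.
have E : rotR a c p = p - p ** c - im *: (p ** a) by [].
move: (rotR a c p) E => v E; rewrite /rotL amulDr amulNr [X in X - c ** v]E.
module.
Qed.

End Rotation.

Context {D : cstarType R}.
Local Notation A := (D : starAlgType R).
Local Notation L := (Lset D : set A).
Implicit Types p h k x y : A.

Lemma LsetP x : L x <-> forall eps : R, 0 < eps ->
  exists y : A, linspan (@projection R D) y /\ nrm (x - y) < eps.
Proof. exact: closureP. Qed.

Lemma Lset_projection p : projection p -> L p.
Proof.
move=> pp; apply/LsetP => e e0; exists p; split; first exact: sub_linspan.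
by rewrite subrr nrm0.
Qed.

Lemma Lset_subspace : lin_subspace L.
Proof.
split.
  apply/LsetP => e e0; exists 0; split.
    by case: (linspan_subspace (@projection R D)).
  by rewrite subrr nrm0.
move=> a x y /LsetP Lx /LsetP Ly; apply/LsetP => e e0.
(* The summand 1 keeps the divisor positive when [a = 0]. *)
have a1 : 0 < 2 * (normc a + 1) by rewrite mulr_gt0 // ltr_wpDl // normc_ge0.
have [x' [px xx']] := Lx _ (divr_gt0 e0 a1).
have [y' [py yy']] := Ly _ (divr_gt0 e0 (ltr0Sn _ 1)).
exists (a *: x' + y'); split.
  by case: (linspan_subspace (@projection R D)) => _; apply.
have -> : a *: x + y - (a *: x' + y') = a *: (x - x') + (y - y') by module.
apply: le_lt_trans (nrmD _ _) _; rewrite nrmZ.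
move: xx'; rewrite ltr_pdivlMr // => xx'.
by have := nrm_ge0 (x - x'); have := normc_ge0 a; nra.
Qed.

Lemma LsetZ a x : L x -> L (a *: x).
Proof. exact: subspaceZ Lset_subspace. Qed.

Lemma LsetD x y : L x -> L y -> L (x + y).
Proof. exact: subspaceD Lset_subspace. Qed.

Lemma LsetB x y : L x -> L y -> L (x - y).
Proof. exact: subspaceB Lset_subspace. Qed.

Lemma LsetN x : L x -> L (- x).
Proof. exact: subspaceN Lset_subspace. Qed.

Lemma Lset_sum (I : Type) (r : seq I) (F : I -> A) :
  (forall i, L (F i)) -> L (\sum_(i <- r) F i).
Proof. exact: subspace_sum Lset_subspace. Qed.

Lemma Lset_closed x :
  (forall eps : R, 0 < eps -> exists y : A, L y /\ nrm (x - y) < eps) -> L x.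
Proof.
move=> Lx; apply/LsetP => e e0; have e2 : 0 < e / 2 by lra.
have [y [/LsetP/(_ _ e2)[z [pz yz]] xy]] := Lx _ e2.
exists z; split=> //; have := nrmD (x - y) (y - z).
by rewrite addrA subrK; lra.
Qed.

(* Conjugation of [p] by the unitary [sqrt (1 - t^2 k^2) + i t k] yields
   projections [p + i t (k p - p k) + O(t^2)]. *)
Lemma Lset_sa_comm p k : projection p -> self_adjoint k ->
  L (im *: (k ** p - p ** k)).
Proof.
move=> pp sk; apply: Lset_closed => e e0.
pose P := nrm p; pose K := nrm k.
have P0 : 0 <= P := nrm_ge0 p; have K0 : 0 <= K := nrm_ge0 k.
(* The second-order error for [t k] is at most [4 P (t K)^2 = (t Q) (e t)]: twice [P (t K)^2] from
   the term with [a] in front, once from each other term. It must be below [e t], so [t] is chosen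
   with both [t K] and [t Q] below 1. *)
have [Q Q0 QE] : exists2 Q, 0 <= Q & Q * e = 4 * P * K ^+ 2.
  exists (4 * P * K ^+ 2 / e); last by rewrite divfK // gt_eqF.
  by apply: divr_ge0; [rewrite !mulr_ge0 ?sqr_ge0 | exact: ltW].
pose t := (K + Q + 1)^-1.
have t0 : 0 < t by rewrite invr_gt0; lra.
have tE : t * K + t * Q + t = 1.
  by rewrite -[X in _ + X]mulr1 -!mulrDr mulVf // gt_eqF //; lra.
have tK0 : 0 <= t * K by rewrite mulr_ge0 // ltW.
have tQ0 : 0 <= t * Q by rewrite mulr_ge0 // ltW.
have tK1 : t * K < 1 by lra.
have tPK : 4 * P * (t * K) ^+ 2 < e * t.
  have -> : 4 * P * (t * K) ^+ 2 = 4 * P * K ^+ 2 * t ^+ 2 by ring.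
  rewrite -QE (_ : _ * _ * _ = t * Q * (e * t)); last by ring.
  by rewrite -[ltRHS]mul1r ltr_pM2r ?mulr_gt0 //; lra.
pose a : A := t%:C *: k.
have a_nrm : nrm a = t * K by rewrite nrmZ_real gtr0_norm.
have [||c [cac c_nrm]] := @circle_exists _ _ a.
- by rewrite /self_adjoint star_real sk.
- by rewrite a_nrm.
pose q := rotL a c (rotR a c p).
exists (t^-1%:C *: (q - p)); split.
  apply: LsetZ; apply: LsetB.
  - by apply: Lset_projection; exact: rot_projection.
  - exact: Lset_projection.
have -> : im *: (k ** p - p ** k) - t^-1%:C *: (q - p) =
    - (t^-1%:C *: (q - p - im *: (a ** p - p ** a))).
  have {1}-> : k ** p - p ** k = t^-1%:C *: (a ** p - p ** a).
    rewrite amulZl amulZr -scalerBr scalerA -rmorphM /= mulVf ?scale1r //.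
    by rewrite gt_eqF.
  module.
have t1 : 0 < t^-1 by rewrite invr_gt0.
rewrite nrmN nrmZ_real gtr0_norm // /q rot_defect.
rewrite mulrC ltr_pdivrMr //.
have := nrmB (im *: (a ** (- (p ** c) - im *: (p ** a))) - c ** rotR a c p) (p ** c).
have := nrmB (im *: (a ** (- (p ** c) - im *: (p ** a)))) (c ** rotR a c p).
rewrite nrm_im.
have := nrmM a (- (p ** c) - im *: (p ** a)).
have := nrmB (- (p ** c)) (im *: (p ** a)); rewrite nrmN nrm_im.
have := nrmM p c; have := nrmM p a; have := nrmM c (rotR a c p).
rewrite nrm_rotR // a_nrm -/P.
have c0 := nrm_ge0 c; rewrite a_nrm in c_nrm.
have pc : P * nrm c <= P * (t * K) ^+ 2 by rewrite ler_wpM2l.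
have cp : nrm c * P <= P * (t * K) ^+ 2 by lra.
set X := nrm (- (p ** c) - _) => h1 h2 h3 h4 h5 h6.
have : t * K * X <= t * K * (P * (t * K) ^+ 2 + P * (t * K)).
  by rewrite ler_wpM2l //; lra.
have : t * K * (P * (t * K) ^+ 2) <= P * (t * K) ^+ 2.
  by rewrite -[leRHS]mul1r ler_wpM2r ?mulr_ge0 ?sqr_ge0 // ltW.
nra.
Qed.

(** The commutator is linear and continuous in [y], which reduces [y] to a projection; the cartesian
    decomposition reduces [x] to self-adjoint elements. *)
Lemma Lset_comm x y : L y -> L (x ** y - y ** x).
Proof.
have sL := Lset_subspace.
have Lp z : linspan (@projection R D) z -> L (x ** z - z ** x).
  move: z; apply: linspan_min => [|p pp].
    split=> [|a y1 y2 L1 L2]; first by rewrite amul0l amul0r subrr; case: sL.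
    have -> : x ** (a *: y1 + y2) - (a *: y1 + y2) ** x =
        a *: (x ** y1 - y1 ** x) + (x ** y2 - y2 ** x).
      by rewrite !amulE; module.
    by apply: LsetD => //; exact: LsetZ.
  have [h [k [sh sk ->]]] := cartesian x.
  have -> : (h + im *: k) ** p - p ** (h + im *: k) =
      (- im) *: (im *: (h ** p - p ** h)) + im *: (k ** p - p ** k).
    by rewrite scaleNr scale_im_im opprK !amulE; module.
  by apply: LsetD; [apply: LsetZ|]; exact: Lset_sa_comm.
move=> /LsetP Ly; apply: Lset_closed => e e0.
have x1 : 0 < 2 * nrm x + 1 by have := nrm_ge0 x; lra.
have [z [pz yz]] := Ly _ (divr_gt0 e0 x1).
exists (x ** z - z ** x); split; first exact: Lp.
have -> : x ** y - y ** x - (x ** z - z ** x) = x ** (y - z) - (y - z) ** x.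
  by rewrite !amulE; module.
apply: le_lt_trans (nrmB _ _) _; move: yz; rewrite ltr_pdivlMr //.
have := nrmM x (y - z); have := nrmM (y - z) x.
by have := nrm_ge0 (y - z); nra.
Qed.

End LieIdeal.

(** * Density of the sums of products *)

Section ProductsDense.
Context {R : realType}.

(** With [a = sin u] this is [exp (2 i u) + exp (- 2 i u) = 2 - 4 sin^2 u], the source of the
    recursion for sines of multiples. *)
Lemma rot_sqrD (D : starAlgType R) (a c z : D) : circle a c ->
  rotL a c (rotL a c z) = z + z -
    (a ** a ** z + a ** a ** z + (a ** a ** z + a ** a ** z)) -
    rotL (- a) c (rotL (- a) c z).
Proof.
move=> [_ _ ac E]; rewrite /rotL !amulE !(scalerN, scalerDr, scale_im_im) ac.
have -> : c ** c ** z = c ** z + c ** z - a ** a ** z.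
  by rewrite -amulDl -E !amulE; module.
module.
Qed.

Context {D : cstarType R}.
Local Notation A := (D : starAlgType R).
Implicit Types x y h s t : A.

(* With [h = sin u], the witness [s] is [sin (r u)], an odd polynomial in [h]
   with linear coefficient [r], and [t] is [sin ((r - 2) u)]; [f - g] is the
   left multiplication by [exp (i r u) - exp (- i r u)]. *)
Lemma sine_multiple (W : set A) h c (n : nat) :
  lin_subspace W -> (forall x y, W (x ** y)) -> circle h c ->
  let r : R := 2 * n%:R + 1 in
  exists s t (f g : A -> A), [/\
    forall y, nrm (f y) = nrm y /\ nrm (g y) = nrm y,
    forall y, f y - g y = im *: (s ** y + s ** y),
    forall y, rotL (- h) c (rotL (- h) c (f y)) - rotL h c (rotL h c (g y)) =
      im *: (t ** y + t ** y),
    W (s - r%:C *: h) & W (t - (r - 2)%:C *: h)].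
Proof.
move=> sW WM ch /=; have ch' := circleN ch.
elim: n => [|n [s [t [f [g [fg_nrm fgB fgB' Ws Wt]]]]]].
  (* For [r = 1] the two sines are [sin u] and [sin (- u)]. *)
  exists h, (- h), (rotL h c), (rotL (- h) c); split.
  - by move=> y; rewrite !nrm_rotL.
  - by move=> y; exact: rotLB.
  - move=> y; rewrite (rotLNK y ch) (rotLK y ch) -opprB rotLB amulNl.
    module.
  - have -> : 2 * 0%:R + 1 = 1 :> R by rewrite mulr0 add0r.
    by rewrite (rmorph1 (real_complex R)) scale1r subrr; case: sW.
  - have -> : 2 * 0%:R + 1 - 2 = -1 :> R by rewrite mulr0; lra.
    by rewrite (rmorphN1 (real_complex R)) scaleN1r opprK addNr; case: sW.
set r : R := 2 * n%:R + 1 in Ws Wt *.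
have rS : 2 * n.+1%:R + 1 = r + 2 by rewrite /r -natr1; lra.
(* The recursion [sin ((r + 2) u) = (2 - 4 h^2) sin (r u) - sin ((r - 2) u)]; modulo [W] the
   coefficient of [h] becomes [2 r - (r - 2) = r + 2]. *)
exists (s + s - (h ** h ** s + h ** h ** s + (h ** h ** s + h ** h ** s)) - t),
  s, (rotL h c \o rotL h c \o f), (rotL (- h) c \o rotL (- h) c \o g).
split.
- by move=> y; rewrite /= !nrm_rotL //; exact: fg_nrm.
- move=> y /=; rewrite (rot_sqrD (f y) ch) (rot_sqrD (g y) ch') opprK.
  have := fgB y; have := fgB' y.
  move: (rotL (- h) c _) (rotL h c _) => v w E1 E2.
  have -> : f y = g y + im *: (s ** y + s ** y) by rewrite -E2; module.
  have -> : v = w + im *: (t ** y + t ** y) by rewrite -E1; module.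
  rewrite !amulE; module.
- move=> y /=; rewrite (rotLNK (rotL h c (f y)) ch) (rotLNK (f y) ch).
  by rewrite (rotLK (rotL (- h) c (g y)) ch) (rotLK (g y) ch).
- rewrite rS (rmorphD (real_complex R)) (rmorph_nat (real_complex R)).
  have -> : s + s - (h ** h ** s + h ** h ** s + (h ** h ** s + h ** h ** s)) - t
      - (r%:C + 2) *: h =
    (s - r%:C *: h) + (s - r%:C *: h) - (t - (r - 2)%:C *: h) -
    (h ** h ** s + h ** h ** s + (h ** h ** s + h ** h ** s)).
    rewrite (rmorphB (real_complex R)) (rmorph_nat (real_complex R)).
    rewrite scalerBl scalerDl scaler_nat mulr2n.
    by move: (r%:C *: h) => v; module.
  apply: (subspaceB sW); first by apply: (subspaceB sW) => //; exact: subspaceD.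
  by do 2!apply: (subspaceD sW); exact: WM.
- by rewrite rS addrK.
Qed.

(** For [h = sin u], the element [sin (r u) / r] has norm at most [1 / r] and differs from [h] by an
    element of [W]. *)
Lemma products_dense (W : set A) x (eps : R) :
  lin_subspace W -> (forall x y, W (x ** y)) -> 0 < eps ->
  exists y, W y /\ nrm (x - y) < eps.
Proof.
move=> sW WM.
have small h e : self_adjoint h -> nrm h < 1 -> 0 < e ->
    exists y, W y /\ nrm (h - y) < e.
  move=> sh h1 e0; have [c [ch _]] := circle_exists sh h1.
  (* Here [1 / (n + 1) < e], and [r = 2 n + 1] is at least [n + 1]. *)
  have [n ne] := ltr_add_invr e0; rewrite add0r in ne.
  have [s [t [f [g [fg_nrm fgB _ Ws _]]]]] := sine_multiple n sW WM ch.
  move: Ws; set r : R := 2 * n%:R + 1 => Ws.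
  have n0 : 0 <= n%:R :> R by [].
  have r1 : n.+1%:R <= r by rewrite /r -natr1; lra.
  have r0 : 0 < r by rewrite /r; lra.
  have s1 : nrm s <= 1.
    apply: nrm_le1 => y; have := nrmB (f y) (g y).
    rewrite fgB nrm_im nrm_double; have [-> ->] := fg_nrm y; lra.
  exists ((- r^-1%:C) *: (s - r%:C *: h)); split; first exact: subspaceZ.
  have -> : h - - r^-1%:C *: (s - r%:C *: h) = r^-1%:C *: s.
    rewrite scalerBr !scaleNr scalerA -rmorphM /= mulVf ?gt_eqF //.
    by rewrite scale1r; module.
  rewrite nrmZ_real gtr0_norm ?invr_gt0 //; apply: le_lt_trans ne.
  rewrite -[leRHS]mulr1; apply: ler_pM => //; first by rewrite invr_ge0 ltW.
    exact: nrm_ge0.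
  by rewrite lef_pV2 // posrE.
have sa h e : self_adjoint h -> 0 < e -> exists y, W y /\ nrm (h - y) < e.
  move=> sh e0; have t0 : 0 < nrm h + 1 by rewrite ltr_wpDl ?nrm_ge0.
  pose t := (nrm h + 1)^-1; have t1 : 0 < t by rewrite invr_gt0.
  have [|||y [Wy hy]] := small (t%:C *: h) (t * e).
  - by rewrite /self_adjoint star_real sh.
  - by rewrite nrmZ_real gtr0_norm // mulrC ltr_pdivrMr // mul1r ltrDl.
  - exact: mulr_gt0.
  exists (t^-1%:C *: y); split; first exact: subspaceZ.
  have -> : h - t^-1%:C *: y = t^-1%:C *: (t%:C *: h - y).
    rewrite scalerBr scalerA -rmorphM /= mulVf ?scale1r //.
    by rewrite gt_eqF.
  by rewrite nrmZ_real gtr0_norm ?invr_gt0 // mulrC ltr_pdivrMr // mulrC.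
move=> e0; have e2 : 0 < eps / 2 by lra.
have [h [k [sh sk ->]]] := cartesian x.
have [y [Wy hy]] := sa _ _ sh e2; have [z [Wz kz]] := sa _ _ sk e2.
exists (y + im *: z); split.
  by apply: subspaceD => //; exact: subspaceZ.
have -> : h + im *: k - (y + im *: z) = (h - y) + im *: (k - z) by module.
by apply: le_lt_trans (nrmD _ _) _; rewrite nrm_im; lra.
Qed.

End ProductsDense.

(** * Projections near almost idempotent self-adjoint elements *)

Section AlmostProjection.
Context {R : realType}.

(** For [e = b^2 - b] this is [3 b^2 - 2 b^3]: Newton's step with [2 b - 1] in place of its own
    inverse, justified by [(2 b - 1)^2 = 1 + 4 e]. *)
Definition newton (D : starAlgType R) (b e : D) := b + e - (b ** e + b ** e).

(** The new defect is [4 e^3 - 3 e^2]. As [e] commutes with [b], every word reduces to one with at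
    most one [b], in front. *)
Lemma newton_defect (D : starAlgType R) (b e : D) : b ** b = b + e ->
  newton b e ** newton b e - newton b e =
  (e ** e ** e + e ** e ** e) + (e ** e ** e + e ** e ** e)
  - (e ** e + e ** e + e ** e).
Proof.
move=> bb.
have eb : e ** b = b ** e.
  by apply: (addrI (b ** b)); rewrite -amulDl -amulDr -bb amulA.
have xeb x : x ** e ** b = x ** b ** e by rewrite -!amulA eb.
have xbb x : x ** b ** b = x ** b + x ** e by rewrite -amulA bb amulDr.
rewrite /newton !(amulE, eb, xeb, bb, xbb); module.
Qed.

Context {D : cstarType R}.
Local Notation A := (D : starAlgType R).
Implicit Types b q : A.

(* Newton's iteration for [x ^ 2 = x] converges quadratically. *)
Lemma almost_projection b : self_adjoint b -> nrm (b ** b - b) <= 8^-1 ->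
  exists q, projection q /\ nrm (q - b) <= 10 * nrm (b ** b - b).
Proof.
move=> sb be; pose e x : A := x ** x - x.
have eE x : x ** x = x + e x by rewrite /e addrC subrK.
have [b_ [b_0 b_S]] : exists b_ : nat -> A, b_ 0%N = b /\
    forall n, b_ n.+1 = newton (b_ n) (e (b_ n)).
  by exists (fix b_ n := if n is m.+1 then newton (b_ m) (e (b_ m)) else b).
(* A defect of norm at most [1/8] shrinks by the factor [4/64 + 3/8 = 7/16] or better. *)
have eS n : nrm (e (b_ n)) <= 8^-1 -> nrm (e (b_ n.+1)) <= nrm (e (b_ n)) / 2.
  rewrite b_S [e (newton _ _)]/e (newton_defect (eE _)); set x := e (b_ n) => x8.
  apply: le_trans (nrmB _ _) _.
  have := nrmD (x ** x + x ** x) (x ** x); rewrite !nrm_double.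
  have := nrmM (x ** x) x; have := nrmM x x; have := nrm_ge0 x => x0 h1 h2 h3.
  have : nrm x * nrm x <= 8^-1 * nrm x by rewrite ler_wpM2r.
  have : nrm (x ** x) * nrm x <= 64^-1 * nrm x.
    rewrite ler_wpM2r //; apply: le_trans h1 _.
    by rewrite (_ : 64^-1 = 8^-1 * 8^-1) ?ler_pM //; lra.
  by lra.
have e8 n : nrm (e (b_ n)) <= 8^-1.
  elim: n => [|n IHn]; first by rewrite b_0.
  by have := eS n IHn; have := nrm_ge0 (e (b_ n)); lra.
have b_sa n : self_adjoint (b_ n).
  rewrite /self_adjoint; elim: n => [|n IHn]; first by rewrite b_0.
  rewrite b_S /newton /e !starE !IHn !amulE.
  by [].
(* The norm [v] of [b_ n] satisfies [v^2 <= v + 1/8]. *)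
have b2 n : nrm (b_ n) <= 2.
  have := nrmD (b_ n) (e (b_ n)); rewrite -eE nrm_sqr //.
  by have := e8 n; have := nrm_ge0 (b_ n); nra.
(* An increment [e - 2 b e] has norm at most [5 * nrm e]; as the defect halves, twice that bounds
   all later increments together. *)
pose d n := 10 * nrm (e (b_ n)).
have d0 n : 0 <= d n by rewrite mulr_ge0 ?nrm_ge0.
have dS n : d n.+1 <= 2^-1 * d n by rewrite /d; have := eS n (e8 n); lra.
have step n : nrm (b_ n.+1 - b_ n) <= d n - d n.+1.
  have -> : b_ n.+1 - b_ n = e (b_ n) - (b_ n ** e (b_ n) + b_ n ** e (b_ n)).
    by rewrite b_S /newton; module.
  apply: le_trans (nrmB _ _) _; rewrite nrm_double.
  have := nrmM (b_ n) (e (b_ n)).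
  have := ler_wpM2r (nrm_ge0 (e (b_ n))) (b2 n).
  by have := eS n (e8 n); rewrite /d; lra.
have r01 : 0 <= (2^-1 : R) < 1 by apply/andP; split; lra.
have [q qd] := geometric_limit r01 dS d0 step.
have lim0 (x : A) K := @eq0_geometric _ _ _ _ K x r01 dS d0.
exists q; split; last by have := qd 0%N; rewrite /d b_0.
split; apply: subr0_eq.
  apply: (lim0 _ 2) => n; rewrite (starBB _ (b_sa n)).
  by apply: le_trans (nrmB _ _) _; rewrite nrm_star; have := qd n; lra.
apply: (lim0 _ (nrm q + 4)) => n.
have -> : q ** q - q =
    (q ** (q - b_ n) + (q - b_ n) ** b_ n) - (q - b_ n) + e (b_ n).
  by rewrite !amulE eE; module.
apply: le_trans (nrmD _ _) _.
have := nrmB (q ** (q - b_ n) + (q - b_ n) ** b_ n) (q - b_ n).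
have := nrmD (q ** (q - b_ n)) ((q - b_ n) ** b_ n).
have := nrmM q (q - b_ n); have := nrmM (q - b_ n) (b_ n).
have := ler_wpM2l (nrm_ge0 q) (qd n).
have := ler_wpM2l (nrm_ge0 (q - b_ n)) (b2 n).
have : nrm (e (b_ n)) <= d n by have := nrm_ge0 (e (b_ n)); rewrite /d; lra.
by have := qd n; lra.
Qed.

End AlmostProjection.

Lemma star_hom_Lset (R : realType) (D E : cstarType R)
    (f : (D : starAlgType R) -> (E : starAlgType R)) (x : (D : starAlgType R)) :
  star_hom f -> Lset D x -> Lset E (f x).
Proof.
move=> f_hom /LsetP Lx; apply: Lset_closed => eps eps0.
have [y [py xy]] := Lx _ eps0; exists (f y); split; last first.
  by rewrite -(star_homB f_hom); apply: le_lt_trans xy; exact: star_hom_contractive.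
move: y py {xy}; apply: linspan_min => [|p pp].
  split=> [|a y z Ly Lz].
    by rewrite /mkset (star_hom0 f_hom); case: (@Lset_subspace R E).
  rewrite (star_homD f_hom) (star_homZ f_hom).
  by apply: LsetD => //; exact: LsetZ.
by apply: Lset_projection; exact: star_hom_projection.
Qed.

(** * Matrix units with coefficients in [B], represented in [L] *)

Section MatrixUnits.
Context {R : realType} {B L : cstarType R} {I : eqType}.
Local Notation sB := (B : starAlgType R).
Local Notation sL := (L : starAlgType R).
Context (F : I -> I -> sB -> sL).
Context (F_linear : forall i j a x y,
  F i j (a *: x + y) = a *: F i j x + F i j y).
Context (F_mul : forall i j k l x y,
  F i j x ** F k l y = if j == k then F i l (x ** y) else 0).
Context (F_star : forall i j x, star (F i j x) = F j i (star x)).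

Lemma matrix_unit_hom i : star_hom (F i i).
Proof. by split=> [a x y|x y|x]; rewrite ?F_linear ?F_mul ?eqxx ?F_star. Qed.

Lemma matrix_unit0 i j : F i j 0 = 0.
Proof.
apply: (addrI (F i j 0)); rewrite addr0 -[X in X + _ = _]scale1r -F_linear.
by rewrite addr0 scaler0.
Qed.

Lemma matrix_unitB i j x y : F i j (x - y) = F i j x - F i j y.
Proof. by rewrite addrC -scaleN1r F_linear scaleN1r addrC. Qed.

(** Off the diagonal [F i j] is not multiplicative, but the C*-identity reduces its norm to that of
    the homomorphism [F j j] at [star x ** x]. *)
Lemma matrix_unit_contractive i j x : nrm (F i j x) <= nrm x.
Proof.
rewrite -(@ler_pXn2r _ 2) ?nnegrE ?nrm_ge0 //.
rewrite -!nrm_cstar F_star F_mul eqxx.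
exact: (star_hom_contractive (matrix_unit_hom j)).
Qed.

Lemma matrix_unit_dense i j :
  (forall x y, Lset L (F i j (x ** y))) -> forall x, Lset L (F i j x).
Proof.
move=> LM x; apply: Lset_closed => eps eps0.
have [||y [Ly xy]] := @products_dense _ _ [set x | Lset L (F i j x)] x _ _ _ eps0.
- split=> [|a y z /= Ly Lz].
    by rewrite /= matrix_unit0; case: (@Lset_subspace R L).
  by rewrite F_linear; apply: LsetD => //; exact: LsetZ.
- exact: LM.
exists (F i j y); split => //; apply: le_lt_trans xy.
by rewrite -matrix_unitB matrix_unit_contractive.
Qed.

(* [Lset L] is a Lie ideal, so it suffices to write the matrix units outside the
   corner [i0] as commutators. *)
Lemma matrix_units_Lset i0 : (forall x, Lset L (F i0 i0 x)) ->
  forall i j x, Lset L (F i j x).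
Proof.
move=> L00.
have L0r j : j != i0 -> forall x, Lset L (F i0 j x).
  move=> j0; apply: matrix_unit_dense => x y.
  have := @Lset_comm _ _ (F i0 j y) _ (L00 x).
  rewrite !F_mul (negPf j0) eqxx sub0r => /LsetN.
  by rewrite opprK.
have Lr0 i : i != i0 -> forall x, Lset L (F i i0 x).
  move=> i1; apply: matrix_unit_dense => x y.
  have := @Lset_comm _ _ (F i i0 x) _ (L00 y).
  by rewrite !F_mul eqxx eq_sym (negPf i1) subr0.
move=> i j; have [->|i1] := eqVneq i i0.
  by have [->|j0] := eqVneq j i0; [exact: L00 | exact: L0r].
have [->|j0] := eqVneq j i0; first exact: Lr0.
apply: matrix_unit_dense => x y.
(* The commutator is [F i j (x ** y)], except that for [i = j] it also contains
   [- F i0 i0 (y ** x)], a corner term that is added back. *)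
have := @Lset_comm _ _ (F i i0 x) _ (L0r j j0 y); rewrite !F_mul eqxx => LB.
rewrite -(subrK (if j == i then F i0 i0 (y ** x) else 0) (F i j _)).
apply: LsetD => //; case: ifP => _; first exact: L00.
by case: (@Lset_subspace R L).
Qed.

End MatrixUnits.

(** * Decomposition of direct sums of matrix algebras into matrix units *)

Section MatSum.
Context {R : realType}.

Definition mxunit (B : starAlgType R) (n : nat) (a b : 'I_n) (x : B) :
    starmx B n :=
  \matrix_(i, j) (if (i == a) && (j == b) then x else 0).

Lemma mxunit_linear (B : starAlgType R) n (i j : 'I_n) a (x y : B) :
  mxunit i j (a *: x + y) = a *: mxunit i j x + mxunit i j y.
Proof.
apply/matrixP => u v; rewrite !mxE.
by case: ifP => _; rewrite ?scaler0 ?addr0.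
Qed.

Lemma mxunit_mul (B : starAlgType R) n (i j k l : 'I_n) (x y : B) :
  mxunit i j x ** mxunit k l y = if j == k then mxunit i l (x ** y) else 0.
Proof.
apply/matrixP => u v; rewrite !mxE.
under eq_bigr => w _ do rewrite !mxE.
rewrite (bigD1 j) //= eqxx andbT big1 ?addr0 => [|w wj]; last first.
  by rewrite (negPf wj) andbF amul0l.
have [_|_] := eqVneq j k.
  by rewrite !mxE /=; case: (u == i); case: (v == l); rewrite ?amul0l ?amul0r.
by rewrite !mxE /= amul0r.
Qed.

Lemma mxunit_star (B : starAlgType R) n (i j : 'I_n) (x : B) :
  star (mxunit i j x) = mxunit j i (star x).
Proof.
by apply/matrixP => u v; rewrite !mxE andbC; case: ifP => _; rewrite ?star0.
Qed.

Lemma starmx_sumE (B : starAlgType R) n (I : Type) (r : seq I) (P : pred I)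
    (X : I -> starmx B n) u v :
  (\sum_(i <- r | P i) X i) u v = \sum_(i <- r | P i) X i u v.
Proof. by apply: (big_morph (fun Y : starmx B n => Y u v)) => [Y Z|]; rewrite mxE. Qed.

Lemma starmx_sum_mxunit (B : starAlgType R) n (X : starmx B n) :
  X = \sum_i \sum_j mxunit i j (X i j).
Proof.
apply/matrixP => u v; rewrite starmx_sumE (bigD1 u) //= starmx_sumE (bigD1 v) //=.
rewrite [X in _ = _ + X]big1 => [|i iu]; last first.
  by rewrite starmx_sumE big1 // => j _; rewrite mxE eq_sym (negPf iu).
rewrite [X in _ = _ + X + _]big1 => [|j jv]; last first.
  by rewrite mxE [v == j]eq_sym (negPf jv) andbF.
by rewrite !addr0 mxE !eqxx.
Qed.

Lemma corner_mxunit (B : starAlgType R) n (n0 : (0 < n)%N) (x : B) :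
  corner n x = mxunit (Ordinal n0) (Ordinal n0) x.
Proof. by apply/matrixP => i j; rewrite !mxE. Qed.

Lemma summand_hom (k : nat) (M : 'I_k -> starAlgType R) t :
  star_hom (@summand R k M t).
Proof.
split=> [a x y|x y|x]; apply: functional_extensionality_dep => s.
- rewrite /GRing.scale /= /starsum_scale /GRing.add /= /starsum_add /summand.
  by case: eqP => [ts|_]; [case: s / ts | rewrite scaler0 addr0].
- rewrite /amul /= /starsum_mul /summand.
  by case: eqP => [ts|_]; [case: s / ts | rewrite amul0l].
- rewrite /star /= /starsum_star /summand.
  by case: eqP => [ts|_]; [case: s / ts | rewrite star0].
Qed.

Lemma starsum_sum_summand (k : nat) (M : 'I_k -> starAlgType R)
    (f : starsum M) : f = \sum_t summand (f t).
Proof.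
apply: functional_extensionality_dep => s.
have -> : (\sum_t summand (f t)) s = \sum_t (summand (f t) : starsum M) s.
  by apply: (big_morph (fun g : starsum M => g s)).
rewrite (bigD1 s) //= big1 ?addr0 => [|t ts].
  (* Equality of indices is decidable, so the transport along [ss : s = s] is the identity. *)
  by rewrite /summand; case: eqP => // ss; rewrite (eq_axiomK ss).
by rewrite /summand; case: eqP => // st; rewrite st eqxx in ts.
Qed.

End MatSum.

(** * Lifting from the limit to a finite stage *)

Section InductiveLimit.
Context {R : realType} {A : nat -> cstarType R}.
Context {phi : forall i, A i -> A i.+1}.
Context (phi_hom : forall i, star_hom (@phi i)).

Lemma connecting_hom i d : star_hom (@connecting R A phi i d).
Proof.
elim: d => [|d IHd]; first by split.
exact: star_hom_comp IHd (phi_hom _).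
Qed.

(* The types [A (d' + d + i)] and [A (d' + (d + i))] are equal but not
   convertible, hence the dependent pairs. *)
Lemma connectingD i d d' (x : A i) :
  existT (fun j => A j : Type) (d' + d + i)%N (connecting phi (d' + d) x) =
  existT (fun j => A j : Type) (d' + (d + i))%N
    (connecting phi d' (connecting phi d x)).
Proof.
elim: d' => [//|d' IHd'].
exact: (congr1 (fun u => existT (fun j => A j : Type) (projT1 u).+1
  (phi (projT2 u))) IHd').
Qed.

Context {L : cstarType R} {psi : forall i, A i -> L}.
Context (L_lim : is_inductive_limit phi psi).
Local Notation sL := (L : starAlgType R).
Local Notation sA i := (A i : starAlgType R).

Let psi_hom i : star_hom (@psi i) := lim_hom L_lim i.

Lemma psi_connecting i d (x : A i) : psi (connecting phi d x) = psi x.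
Proof. by elim: d => [//|d IHd]; rewrite /= (lim_compat L_lim). Qed.

Lemma lim_nrm i (x : sA i) (eps : R) : 0 < eps ->
  exists d, nrm (connecting phi d x) < nrm (psi x) + eps.
Proof.
move=> eps0; have /cvgrPdist_lt/(_ eps%:C)[|N _ NP] := @Defs.lim_norm _ _ _ _ _ L_lim i x.
  by rewrite ltcR.
exists N; have := NP N (leqnn N).
rewrite /= (nrmE (psi x)) (nrmE (connecting _ _ _)) -rmorphB /= normc_def /=.
rewrite expr0n addr0 sqrtr_sqr ltcR distrC.
by have := ler_norm (nrm (connecting phi N x) - nrm (psi x)); lra.
Qed.

(** Claiming only existence at each stage [j] spares an explicit transport of the image of [y] along
    [d + N = j]. *)
Lemma lift_forward (P : forall j, A j -> Prop) (N : nat) (y : A N) :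
  (forall j z, P j z -> P j.+1 (phi z)) -> P N y ->
  forall j, (N <= j)%N -> exists z, P j z.
Proof.
move=> P_phi Py; elim=> [|j IHj].
  by rewrite leqn0 => /eqP N0; case: _ / N0; exists y.
rewrite leq_eqVlt => /orP[/eqP <-|]; first by exists y.
by rewrite ltnS => /IHj[z Pz]; exists (phi z); exact: P_phi.
Qed.

(** A self-adjoint [b] with [psi b] near [p] has a small defect in the limit, hence at some later
    stage, where [almost_projection] applies. *)
Lemma lift_projection (p : sL) (eps : R) : projection p -> 0 < eps ->
  exists N (q : sA N), projection q /\ nrm (psi q - p) < eps.
Proof.
move=> [sp pp] eps0.
(* The defect is at most [4 del] in the limit and [5 del <= 1/8] at a later stage; correcting it
   costs [50 del], and [psi b] is within [del] of [p], giving [51 del < eps]. *)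
pose del := Num.min 40^-1 (eps / 52).
have del0 : 0 < del by rewrite lt_min; apply/andP; split; lra.
have del1 : del <= 40^-1 by rewrite /del ge_min lexx.
have del2 : del <= eps / 52 by rewrite /del ge_min lexx orbT.
have : closure (\bigcup_i range (@psi i)) p by rewrite (lim_dense L_lim).
move=> /closureP/(_ _ del0)[_ [[j _ [b0 _ <-]] pb0]].
pose b : sA j := halfc *: (b0 + star b0).
have sb : self_adjoint b by rewrite /self_adjoint !starE starK addrC.
have pb : nrm (psi b - p) <= del.
  rewrite /b (star_homZ (psi_hom j)) (star_homD (psi_hom j)).
  rewrite (star_hom_star (psi_hom j)) -[X in _ - X](scale_half p) -{2}sp.
  have -> : halfc *: ((psi b0 : sL) + star (psi b0)) - halfc *: (p + star p) =
      halfc *: ((psi b0 - p : sL) + star (psi b0 - p : sL)).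
    by rewrite !starE; module.
  rewrite nrm_half; have := nrmD (psi b0 - p : sL) (star (psi b0 - p : sL)).
  by rewrite nrm_star -(nrmBC p); lra.
have p1 : nrm p <= 1.
  have := nrm_sqr sp; rewrite pp => p2; have := nrm_ge0 p.
  have [->|p0] := eqVneq (nrm p) 0; first by [].
  by move=> pge0; have := mulf_neq0 p0 p0; nra.
have defect : nrm (psi (b ** b - b)) <= 4 * del.
  rewrite (star_homB (psi_hom j)) (star_homM (psi_hom j)).
  move: (psi b : sL) pb => v pv.
  have -> : v ** v - v = v ** (v - p) + (v - p) ** p - (v - p).
    by rewrite !amulE pp; module.
  have := nrmB (v ** (v - p) + (v - p) ** p) (v - p).
  have := nrmD (v ** (v - p)) ((v - p) ** p).
  have := nrmM v (v - p); have := nrmM (v - p) p.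
  have v2 : nrm v <= 2 by have := nrmD (v - p) p; rewrite subrK; lra.
  have := ler_wpM2r (nrm_ge0 (v - p)) v2.
  have := ler_wpM2l (nrm_ge0 (v - p)) p1.
  by lra.
have [d dP] := lim_nrm (b ** b - b) del0.
have d_hom := connecting_hom j d.
have [||q [qp qb]] := @almost_projection _ _ (connecting phi d b).
- exact: star_hom_sa.
- by rewrite -(star_homM d_hom) -(star_homB d_hom); lra.
exists (d + j)%N, q; split=> //.
rewrite -(star_homM d_hom) -(star_homB d_hom) in qb.
have := star_hom_contractive (psi_hom (d + j)%N) (q - connecting phi d b).
rewrite (star_homB (psi_hom _)) psi_connecting => qb'.
have := nrmD (psi q - psi b : sL) (psi b - p : sL).
by rewrite addrA subrK; lra.
Qed.

(** Having approximants at all stages from [N] on lets those of two summands be added at a common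
    stage. *)
Lemma lift_linspan (v : sL) (eps : R) : linspan (@projection R L) v -> 0 < eps ->
  exists N, forall j, (N <= j)%N ->
    exists y : sA j, linspan (@projection R (A j)) y /\ nrm (psi y - v) < eps.
Proof.
move=> pv; move: v pv eps; apply: linspan_min => [|p pp] /=.
  split=> [|a x y IHx IHy] eps eps0.
    exists 0%N => j _; exists 0; split.
      by case: (linspan_subspace (@projection R (A j))).
    by rewrite (star_hom0 (psi_hom j)) subrr nrm0.
  have a1 : 0 < 2 * (normc a + 1) by rewrite mulr_gt0 // ltr_wpDl // normc_ge0.
  have [N1 P1] := IHx _ (divr_gt0 eps0 a1).
  have [N2 P2] := IHy _ (divr_gt0 eps0 (ltr0Sn _ 1)).
  exists (maxn N1 N2) => j; rewrite geq_max => /andP[/P1[x' [px xx']] /P2[y' [py yy']]].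
  exists (a *: x' + y'); split.
    by case: (linspan_subspace (@projection R (A j))) => _; apply.
  rewrite (star_homD (psi_hom j)) (star_homZ (psi_hom j)).
  move: (psi x' : sL) (psi y' : sL) xx' yy' => x1 y1 xx' yy'.
  have -> : a *: x1 + y1 - (a *: x + y) = a *: (x1 - x) + (y1 - y) by module.
  apply: le_lt_trans (nrmD _ _) _; rewrite nrmZ.
  move: xx'; rewrite ltr_pdivlMr // => xx'.
  by have := nrm_ge0 (x1 - x); have := normc_ge0 a; nra.
move=> eps eps0; have [N [q [qp pq]]] := lift_projection pp eps0.
exists N; apply: (@lift_forward (fun j (y : sA j) =>
  linspan (@projection R (A j)) y /\ nrm (psi y - p) < eps) N q); last first.
  by split=> //; exact: sub_linspan.
move=> j z [pz zp]; split; last by rewrite (lim_compat L_lim).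
move: z pz {zp}; apply: linspan_min => [|z pz].
  split=> [|a y z ly lz].
    rewrite /mkset (star_hom0 (phi_hom j)).
    by case: (linspan_subspace (@projection R (A j.+1))).
  rewrite /mkset (star_homD (phi_hom j)) (star_homZ (phi_hom j)).
  by case: (linspan_subspace (@projection R (A j.+1))) => _; apply.
by apply: sub_linspan; exact: star_hom_projection.
Qed.

Lemma lift_Lset i (x : sA i) (eps : R) : Lset L (psi x) -> 0 < eps ->
  exists d (y : sA (d + i)%N), Lset (A (d + i)%N) y /\
    nrm (connecting phi d x - y) < eps.
Proof.
move=> /LsetP Lx eps0; have eps3 : 0 < eps / 3 by lra.
have [v [pv xv]] := Lx _ eps3.
have [N /(_ (N + i)%N (leq_addr _ _))[y [py yv]]] := lift_linspan pv eps3.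
have d_hom := connecting_hom i N.
(* At stage [N + i] the difference is small only after mapping to the limit, so one moves [d] stages
   further. *)
have [d dP] := lim_nrm (connecting phi N x - y) eps3.
have {}dP : nrm (connecting phi d (connecting phi N x - y)) < eps.
  apply: lt_le_trans dP _.
  rewrite (star_homB (psi_hom _)) psi_connecting.
  have := nrmB (psi x - v : sL) (psi y - v : sL).
  by rewrite opprB addrA subrK; lra.
exists (d + N)%N.
(* Phrasing the goal over the dependent pair makes [connectingD] applicable as a rewrite rule. *)
suff : exists y : sA (projT1 (existT (fun j => A j : Type) (d + N + i)%N
    (connecting phi (d + N) x))), Lset (A _) y /\
    nrm (projT2 (existT (fun j => A j : Type) (d + N + i)%N
      (connecting phi (d + N) x)) - y : sA _) < eps by [].
rewrite connectingD /=; exists (connecting phi d y).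
have d'_hom := connecting_hom (N + i)%N d.
split; last by rewrite -(star_homB d'_hom).
apply: star_hom_Lset d'_hom _; apply/LsetP => e e0.
by exists y; rewrite subrr nrm0.
Qed.

Lemma LP_limit : (forall i (x : A i), Lset L (psi x)) -> LP_property L.
Proof.
move=> Lpsi; apply/seteqP; split=> // x _; apply: Lset_closed => eps eps0.
have : closure (\bigcup_i range (@psi i)) x by rewrite (lim_dense L_lim).
move=> /closureP/(_ _ eps0)[_ [[j _ [y _ <-]] xy]].
by exists (psi y).
Qed.

End InductiveLimit.

(** * The equivalences, through the images of matrix units in the limit *)

Theorem theorem2p1 (R : realType)
  (k : nat -> nat) (n : forall i, 'I_(k i) -> nat)
  (n_gt0 : forall i (t : 'I_(k i)), (0 < n i t)%N)
  (B : forall i, 'I_(k i) -> cstarType R)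
  (A : nat -> cstarType R)
  (e : forall i, matsum (n i) (B i) -> A i)
  (e_iso : forall i, star_iso (e i))
  (phi : forall i, A i -> A i.+1)
  (phi_hom : forall i, star_hom (phi i))
  (L : cstarType R) (psi : forall i, A i -> L)
  (L_lim : is_inductive_limit phi psi)
  (S : forall i (t : 'I_(k i)), set (B i t))
  (S_sa : forall i t (x : B i t), S i t x -> self_adjoint x)
  (S_spans : forall i t, spans (S i t)) :
  (LP_property L <->
    (forall i (t : 'I_(k i)) (x : B i t), S i t x ->
      forall eps : R, 0 < eps ->
      exists (d : nat) (y : A (d + i)%N),
        Lset (A (d + i)%N) y /\
        `|connecting phi d (e i (matsum_corner (n i) x)) - y| < eps%:C))
  /\
  (LP_property L <->
    (forall i, exists T : set (A i),
      spans T /\ forall x, T x -> Lset L (psi i x))).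
Proof.
have psi_hom := lim_hom L_lim.
have e_hom i : star_hom (e i) by case: (e_iso i).
pose F i t (a b : 'I_(n i t)) (x : (B i t : starAlgType R)) :
    (L : starAlgType R) := psi i (e i (summand (mxunit a b x))).
have summandR i t := @summand_hom R _ (fun s => starmx (B i s) (n i s)) t.
have F_linear i t a b c x y : @F i t a b (c *: x + y) = c *: F i t a b x + F i t a b y.
  rewrite /F mxunit_linear (star_homD (summandR i t)) (star_homZ (summandR i t)).
  rewrite (star_homD (e_hom i)) (star_homZ (e_hom i)).
  by rewrite (star_homD (psi_hom i)) (star_homZ (psi_hom i)).
have F_mul i t a b c d x y : @F i t a b x ** F i t c d y =
    if b == c then F i t a d (x ** y) else 0.
  rewrite /F -(star_homM (psi_hom i)) -(star_homM (e_hom i)).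
  rewrite -(star_homM (summandR i t)) mxunit_mul; case: ifP => // _.
  by rewrite (star_hom0 (summandR i t)) (star_hom0 (e_hom i)) (star_hom0 (psi_hom i)).
have F_star i t a b x : star (@F i t a b x) = F i t b a (star x).
  rewrite /F -(star_hom_star (psi_hom i)) -(star_hom_star (e_hom i)).
  by rewrite -(star_hom_star (summandR i t)) mxunit_star.
split; split.
- move=> LP i t x _ eps eps0.
  have [|d [y [Ly xy]]] := lift_Lset phi_hom L_lim
      (i := i) (x := e i (matsum_corner (n i) x)) _ eps0.
    by rewrite LP.
  by exists d, y; split=> //; rewrite (nrmE (_ - _)) ltcR.
- move=> approx; apply: (LP_limit L_lim) => i x.
  have [_ [e' _ e'K]] := e_iso i.
  rewrite -(e'K x); move: (e' x) => f {x}.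
  rewrite (starsum_sum_summand f) (star_hom_sum (e_hom i)) (star_hom_sum (psi_hom i)).
  apply: Lset_sum => t.
  rewrite (starmx_sum_mxunit (f t)) (star_hom_sum (summandR i t)).
  rewrite (star_hom_sum (e_hom i)) (star_hom_sum (psi_hom i)).
  apply: Lset_sum => a.
  rewrite (star_hom_sum (summandR i t)).
  rewrite (star_hom_sum (e_hom i)) (star_hom_sum (psi_hom i)).
  apply: Lset_sum => b.
  (* The index of the corner in which [matsum_corner] places the elements of [S i t]. *)
  pose o := Ordinal (n_gt0 i t).
  apply: (matrix_units_Lset (F_linear i t) (F_mul i t) (F_star i t) (i0 := o)) => x.
  have : linspan (S i t) x by rewrite S_spans.
  move: x; apply: linspan_min => [|x Sx].
    split=> [|c x y Lx Ly].
      by rewrite /mkset (matrix_unit0 (F_linear i t)); case: (@Lset_subspace R L).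
    by rewrite /mkset F_linear; apply: LsetD => //; exact: LsetZ.
  rewrite /mkset /F /o -corner_mxunit.
  (* The approximation at stage [d + i] is pushed to the limit by [psi], which is contractive and
     preserves closed spans of projections. *)
  apply: Lset_closed => eps eps0; have [d [y [Ly xy]]] := approx i t x Sx eps eps0.
  exists (psi _ y); split; first exact: star_hom_Lset (psi_hom _) Ly.
  rewrite -/(matsum_corner _ _) -(psi_connecting L_lim d) -(star_homB (psi_hom _)).
  apply: le_lt_trans (star_hom_contractive (psi_hom _) _) _.
  by rewrite -ltcR -(nrmE (_ - _)).
- move=> LP i; exists setT; split; last by move=> x _; rewrite LP.
  by apply/seteqP; split=> // x _; exact: sub_linspan.
- move=> spanT; apply: (LP_limit L_lim) => i x.
  have [T [T_spans LT]] := spanT i.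
  have : linspan T x by rewrite T_spans.
  move: x; apply: linspan_min => // ; split=> [|c x y Lx Ly].
    by rewrite /mkset (star_hom0 (psi_hom i)); case: (@Lset_subspace R L).
  rewrite /mkset (star_homD (psi_hom i)) (star_homZ (psi_hom i)).
  by apply: LsetD => //; exact: LsetZ.
Qed.
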